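(* Let $(\mathcal{S},D_{\mathcal{S}},A_{D_{\mathcal{S}}})$ be a refined algebraic domain with poles, where $A_{D_{\mathcal{S}}}=F_{D_{\mathcal{S}},1}\cup F_{D_{\mathcal{S}},2}$, and let $(D_{j'},x_{j'})$ with $x_{j'}\in D_{j'}\cap(\overline{D_{\mathcal{S}}}-D_{\mathcal{S}})$ be an admissible pointed set for it, with associated curve $S_{j'}$ and family $\mathcal{S}'=\mathcal{S}\sqcup\{S_{j'}\}$. Suppose that the families $\mathcal{S}$ and $\mathcal{S}'$ consist of circles. If $(D_{j'},x_{j'})$ is $(\mathcal{S},D_{\mathcal{S}},A_{D_{\mathcal{S}}})$-LS and $D_{j'}$ is not $(\mathcal{S},D_{\mathcal{S}})$-connected, then the following are satisfied. (1) The intersection $\overline{D_{j'}}\cap(\overline{D_{\mathcal{S}}}-D_{\mathcal{S}})$ contains no circle. (2) The intersection $\overline{D_{j'}}\cap(\overline{D_{\mathcal{S}}}-D_{\mathcal{S}})$ contains at least $l=2$ points contained in exactly two circles from $\mathcal{S}$. Furthermore, the number $l=2$ is optimal (that is, it cannot be replaced by a larger number in this statement).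
   Context: For $i=1,2$, $\pi_{2,1,i}:\mathbb{R}^2\to\mathbb{R}$ denotes the projection $(x_1,x_2)\mapsto x_i$. $\overline{Y}$ denotes closure in $\mathbb{R}^2$. A circle is a set $\{(x_1,x_2)\in\mathbb{R}^2\mid (x_1-x_{0,1})^2+(x_2-x_{0,2})^2=r\}$ with $r>0$. A union of connected components of the zero set of a real polynomial is non-singular if the polynomial has no singular point (point where its differential vanishes) on it. Refined algebraic domain: a pair $(\mathcal{S},D_{\mathcal{S}})$ of a finite family $\mathcal{S}=\{S_j\subset\mathbb{R}^2\}$, each $S_j$ being a non-singular connected component of the zero set of a real polynomial (a curve), and a region $D_{\mathcal{S}}\subset\mathbb{R}^2$ such that: (i) $D_{\mathcal{S}}$ is a bounded connected component of $\mathbb{R}^2-\bigcup_{S_j\in\mathcal{S}}S_j$ and $\overline{D_{\mathcal{S}}}\cap S_j\neq\emptyset$ for every $S_j\in\mathcal{S}$; (ii) at each point of $\overline{D_{\mathcal{S}}}$ at most two distinct curves of $\mathcal{S}$ intersect, and where two distinct curves of $\mathcal{S}$ intersect at a point $p \in \overline{D_{\mathcal{S}}}$, the sum of their tangent spaces at $p$ equals $T_p\mathbb{R}^2$. The finite set $F_{D_{\mathcal{S}},i}$ ($i=1,2$) consists of: all points of $\overline{D_{\mathcal{S}}}$ lying in exactly two distinct curves of $\mathcal{S}$; and, after removing these points from $\overline{D_{\mathcal{S}}}-D_{\mathcal{S}}$ to get a smooth $1$-dimensional manifold without boundary, all singular points of the restriction of $\pi_{2,1,i}$ to this manifold that lie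 in a curve $S_j$ which is not a straight line (not from the zero set of a real polynomial of degree $1$). Refined algebraic domain with poles: a triplet $(\mathcal{S},D_{\mathcal{S}},A_{D_{\mathcal{S}}})$ with $(\mathcal{S},D_{\mathcal{S}})$ a refined algebraic domain and $A_{D_{\mathcal{S}}}\subset\overline{D_{\mathcal{S}}}-D_{\mathcal{S}}$ a finite set with $F_{D_{\mathcal{S}},1}\cup F_{D_{\mathcal{S}},2}\subset A_{D_{\mathcal{S}}}$. Admissible: given a refined algebraic domain with poles $(\mathcal{S},D_{\mathcal{S}},A_{D_{\mathcal{S}}})$, a set $D_{j'}$ (or pointed set $(D_{j'},x_{j'})$) is called admissible here if $D_{j'}$ is a connected component of $\mathbb{R}^2-S_{j'}$ for a connected component $S_{j'}$ of the zero set of a real polynomial, and there is a finite set $A_{j'}\subset S_{j'}$ such that $(\{S_{j'}\},D_{j'},A_{j'})$ is a refined algebraic domain with poles and $(\mathcal{S}'=\mathcal{S}\sqcup\{S_{j'}\},\ D_{\mathcal{S}'}=D_{\mathcal{S}}\cap(\mathbb{R}^2-\overline{D_{j'}}),\ A_{D_{\mathcal{S}'}}=(A_{D_{\mathcal{S}}}\cup A_{j'})\cap\overline{D_{\mathcal{S}'}})$ is a refined algebraic domain with poles. Let $(D_{j'},x)$ be admissible with $x=(x_1,x_2)\in D_{j'}\cap(\overline{D_{\mathcal{S}}}-D_{\mathcal{S}})$. - $D_{j'}$ is $(\mathcal{S},D_{\mathcal{S}})$-connected if $\overline{D_{j'}}\cap\overline{D_{\mathcal{S}}}$ is connected. - $(D_{j'},x)$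 is $(\mathcal{S},D_{\mathcal{S}},A_{D_{\mathcal{S}}})$-LS if the set $(A_{D_{\mathcal{S}}}\cap\overline{D_{j'}}\cap\overline{D_{\mathcal{S}}})-\{x\}$ is empty or a finite set of points of the form $(x_1,x_2')$ or $(x_1',x_2)$ with arbitrary real numbers $x_1',x_2'$. *)

(* Defs.v *)
From mathcomp Require Import all_boot all_order all_algebra.
From mathcomp Require Import all_classical all_reals all_analysis.
(* The notations of mpoly clash with those of MathComp-Analysis. *)
From mathcomp Require Import -(notations) mpoly.
Set Implicit Arguments.
Unset Strict Implicit.
Unset Printing Implicit Defensive.
Import Order.TTheory GRing.Theory Num.Theory.
Import numFieldNormedType.Exports.
Local Open Scope classical_set_scope.
Local Open Scope card_scope.
Local Open Scope ring_scope.

Notation plane R := (R * R)%type.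
Notation poly2 R := (mpoly 2 R).

(* The projection pi_{2,1,i}; the index i = 1, 2 is shifted to 0, 1 in 'I_2. *)
Definition coord (R : realType) (i : 'I_2) (z : plane R) : R :=
  if i == ord0 then z.1 else z.2.

Definition zero_set (R : realType) (f : poly2 R) : set (plane R) :=
  [set z | meval (fun i => coord i z) f = 0].

Definition differential (R : realType) (f : poly2 R) (p v : plane R) : R :=
  \sum_(i < 2) meval (fun i => coord i p) (mderiv i f) * coord i v.

Definition singular_point (R : realType) (f : poly2 R) (p : plane R) : Prop :=
  forall v, differential f p v = 0.

(* [connected_component A x] is empty when x is not in A, hence the guard. *)
Definition is_component (T : topologicalType) (A C : set T) : Prop :=
  exists2 x, A x & C = connected_component A x.

Definition nonsingular_component (R : realType) (f : poly2 R)
    (S : set (plane R)) : Prop :=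
  is_component (zero_set f) S /\ forall p, S p -> ~ singular_point f p.

Definition curve (R : realType) (S : set (plane R)) : Prop :=
  exists f : poly2 R, nonsingular_component f S.

(* The tangent space at p, as the kernel of the differential of a defining
   polynomial without singular point on S; it does not depend on the choice of
   that polynomial. *)
Definition tangent_space (R : realType) (S : set (plane R)) (p : plane R) :
    set (plane R) :=
  [set v | exists2 f : poly2 R,
             nonsingular_component f S & differential f p v = 0].

Definition transversal (R : realType) (S1 S2 : set (plane R)) (p : plane R) :
    Prop :=
  forall w, exists u v,
    [/\ tangent_space S1 p u, tangent_space S2 p v & w = u + v].

(* [msize] is the total degree plus one. *)
Definition straight_line (R : realType) (S : set (plane R)) : Prop :=
  exists2 f : poly2 R, mmeasure mdeg f = 2%N & S = zero_set f.

Definition circle (R : realType) : set (set (plane R)) :=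
  [set C | exists (c : plane R) (r : R), 0 < r /\
     C = [set z | (z.1 - c.1) ^+ 2 + (z.2 - c.2) ^+ 2 = r]].

Section Domains.
Variable R : realType.
Implicit Types (S : set (set (plane R))) (D A : set (plane R)).

Definition curves_at S (p : plane R) : set (set (plane R)) :=
  [set C | S C /\ C p].

Definition boundary D : set (plane R) := closure D `\` D.

Definition double_points S : set (plane R) :=
  [set p | curves_at S p #= `I_2].

Record refined_domain S D : Prop := RefinedDomain {
  refined_finite : finite_set S;
  refined_curve : forall C, S C -> curve C;
  refined_bounded : bounded_set D;
  refined_component : is_component (~` \bigcup_(C in S) C) D;
  refined_meets : forall C, S C -> closure D `&` C !=set0;
  refined_le2 : forall p, closure D p -> curves_at S p #<= `I_2;
  refined_transversal : forall p C1 C2, closure D p -> S C1 -> S C2 ->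
    C1 <> C2 -> C1 p -> C2 p -> transversal C1 C2 p
}.

(* Off the double points, the boundary of D coincides near p with the unique
   curve C of S through p, so that the tangent space at p of the 1-dimensional
   manifold is that of C; p is a singular point of the restricted projection
   when the (linear) projection vanishes on that tangent space. *)
Definition projection_singular S D (i : 'I_2) : set (plane R) :=
  [set p | (boundary D `\` double_points S) p /\
     exists C, [/\ S C, C p, ~ straight_line C &
                   forall v, tangent_space C p v -> coord i v = 0]].

Definition F_set S D (i : 'I_2) : set (plane R) :=
  (closure D `&` double_points S) `|` projection_singular S D i.

Definition refined_domain_with_poles S D A : Prop :=
  [/\ refined_domain S D, finite_set A, A `<=` boundary D &
      \bigcup_i F_set S D i `<=` A].

(* The condition ~ S Sj records that the union of S and {Sj} is disjoint. *)
Definition admissible S D A (Sj Dj : set (plane R)) : Prop :=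
  [/\ exists f : poly2 R, is_component (zero_set f) Sj,
      is_component (~` Sj) Dj,
      ~ S Sj &
      exists Aj : set (plane R),
        [/\ finite_set Aj, Aj `<=` Sj,
            refined_domain_with_poles [set Sj] Dj Aj &
            let D' := D `&` ~` closure Dj in
            refined_domain_with_poles (S `|` [set Sj]) D'
              ((A `|` Aj) `&` closure D')]].

Definition domain_connected D (Dj : set (plane R)) : Prop :=
  connected (closure Dj `&` closure D).

Definition LS D A (Dj : set (plane R)) (x : plane R) : Prop :=
  let E := (A `&` closure Dj `&` closure D) `\ x in
  E = set0 \/
  (finite_set E /\ forall p, E p -> p.1 = x.1 \/ p.2 = x.2).

Record disconnected_LS_circles S D A (Sj Dj : set (plane R)) (x : plane R) :
    Prop := DisconnectedLSCircles {
  dLS_poles : refined_domain_with_poles S D A;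
  dLS_poles_eq : A = \bigcup_i F_set S D i;
  dLS_base : (Dj `&` boundary D) x;
  dLS_admissible : admissible S D A Sj Dj;
  dLS_circles : S `<=` @circle R;
  dLS_circles' : S `|` [set Sj] `<=` @circle R;
  dLS_LS : LS D A Dj x;
  dLS_disconnected : ~ domain_connected D Dj
}.

Definition contains_double_points S D (Dj : set (plane R)) (l : nat) : Prop :=
  `I_l #<= (closure Dj `&` boundary D) `&` double_points S.

End Domains.

(* Main.v *)
(* Let K be the closed disc bounded by the new circle.

   If a circle C were contained in K and in the boundary of D, its four extreme
   points in the coordinate directions would be poles, and all of them lie on the
   two axis-parallel lines through x only if x is the centre of C. Since x is in the
   closure of D, the domain D is then inside C, hence inside K, and nothing of it
   remains outside K.

   For the double points, let B be relatively open and closed in K `&` closure D and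
   without double point. Each circle C meeting B cuts K along a connected set, which
   is contained in B since near a simple point of C the closure of D is one closed
   side of C. Hence the union of B and of the parts of K lying on the other sides of
   these circles is open and closed in K, so it is K, and B is the whole of
   K `&` closure D. If this intersection is disconnected, B and its complement thus
   both contain a double point.

   For optimality, D is the crescent inside |w| = 1 and outside |w - (2, 0)|^2 = 5,
   whose two tips (0, 1) and (0, -1) are cut off by |w - (4, 0)|^2 = 349 / 20. *)
Require Import Defs.
From mathcomp Require Import all_boot all_order all_algebra.
From mathcomp Require Import all_classical all_reals all_analysis.
From mathcomp Require Import -(notations) mpoly.
From mathcomp Require Import ring lra.
Import Order.TTheory GRing.Theory Num.Theory.
Import numFieldNormedType.Exports.
Local Open Scope classical_set_scope.

Set Implicit Arguments.
Unset Strict Implicit.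
Unset Printing Implicit Defensive.
Local Open Scope card_scope.
Local Open Scope ring_scope.
(* [vector.coord] and [finset.transversal] mask the definitions of the same name. *)
Local Notation coord := Defs.coord.
Local Notation transversal := Defs.transversal.

(** * Plane topology *)

Section PlaneTopology.
Variable R : realType.
Implicit Types (c p q w z : plane R) (r s t : R) (A : set (plane R)).

(** The power of a point with respect to a circle; [r] is the squared radius, as in [circle], so the
    sign tells the side of the circle. *)
Definition power c r w : R := (w.1 - c.1) ^+ 2 + (w.2 - c.2) ^+ 2 - r.

Definition seg p q t : plane R := ((1 - t) * p.1 + t * q.1, (1 - t) * p.2 + t * q.2).

Lemma fst_continuous : continuous (fun w : plane R => w.1).
Proof. by move=> w; apply: cvg_fst. Qed.

Lemma snd_continuous : continuous (fun w : plane R => w.2).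
Proof. by move=> w; apply: cvg_snd. Qed.

Lemma power_continuous c r : continuous (power c r).
Proof.
have -> : power c r = (fun w => (w.1 - c.1) * (w.1 - c.1) +
    (w.2 - c.2) * (w.2 - c.2) - r) by [].
move=> w; have c1 := @fst_continuous w; have c2 := @snd_continuous w.
apply: cvgD; last exact: cvg_cst.
by apply: cvgD; apply: cvgM; apply: cvgD => //; exact: cvg_cst.
Qed.

Lemma pair_continuous (T : topologicalType) (f g : T -> R) :
  continuous f -> continuous g -> continuous (fun x => (f x, g x)).
Proof. by move=> cf cg x; exact: cvg_pair (cf x) (cg x). Qed.

Lemma seg_continuous p q : continuous (seg p q).
Proof.
have cl (a b : R) : continuous (fun t : R => (1 - t) * a + t * b).
  move=> t; apply: cvgD; apply: cvgM; try exact: cvg_cst; last exact: cvg_id.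
  by apply: cvgD; [exact: cvg_cst | exact: opp_continuous].
exact: pair_continuous.
Qed.

Lemma seg0 p q : seg p q 0 = p.
Proof. by rewrite /seg subr0 !mul1r !mul0r !addr0 -surjective_pairing. Qed.

Lemma seg1 p q : seg p q 1 = q.
Proof. by rewrite /seg subrr !mul1r !mul0r !add0r -surjective_pairing. Qed.

Lemma star_connected A q :
  (forall p t, A p -> 0 <= t <= 1 -> A (seg p q t)) -> connected A.
Proof.
move=> starA.
have -> : A = \bigcup_(p in A) (seg p q @` `[0, 1]).
  apply/seteqP; split => [p Ap|_ [p Ap [t + <-]]]; last first.
    by rewrite /= in_itv /=; exact: starA.
  by exists p => //; exists 0; rewrite ?seg0//= in_itv /= lexx ler01.
apply: bigcup_connected.
  by exists q => p Ap; exists 1; rewrite ?seg1//= in_itv /= lexx ler01.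
move=> p _; apply: connected_continuous_connected; first exact: segment_connected.
by apply: continuous_subspaceT; exact: seg_continuous.
Qed.

Lemma connected_sign (T : topologicalType) (B : set T) (g : T -> R) :
  connected B -> continuous g -> (forall x, B x -> g x != 0) ->
  (forall x, B x -> 0 < g x) \/ (forall x, B x -> g x < 0).
Proof.
move=> cB cg gN0.
have /connected_intervalP itvgB : connected (g @` B).
  apply: connected_continuous_connected => //.
  exact: continuous_subspaceT.
apply: contrapT => /not_orP[/existsNP[y /not_implyP[By gy]]].
move=> /existsNP[z /not_implyP[Bz gz]].
have [w Bw gw] : (g @` B) 0.
  apply: (itvgB (g y) (g z)); [by exists y|by exists z|].
  by move/negP: gy; move/negP: gz; rewrite -!leNgt => -> ->.
by have := gN0 w Bw; rewrite gw eqxx.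
Qed.

(** The coefficient of [2 * t * (1 - t)] is the polar form of the power: it vanishes when [p] lies
    on the polar line of [q]. *)
Lemma power_seg c r p q t :
  power c r (seg p q t) =
  (1 - t) ^+ 2 * power c r p + t ^+ 2 * power c r q +
  2 * t * (1 - t) * ((p.1 - c.1) * (q.1 - c.1) + (p.2 - c.2) * (q.2 - c.2) - r).
Proof. by rewrite /power /=; ring. Qed.

Lemma power_seg_convex c r p q t :
  power c r (seg p q t) =
  (1 - t) * power c r p + t * power c r q -
  t * (1 - t) * ((p.1 - q.1) ^+ 2 + (p.2 - q.2) ^+ 2).
Proof. by rewrite /power /=; ring. Qed.

Lemma disc_seg c r p q t : 0 <= t <= 1 -> power c r p <= 0 -> power c r q <= 0 ->
  power c r (seg p q t) <= 0.
Proof.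
move=> /andP[t0 t1] hp hq; rewrite power_seg_convex.
have : 0 <= t * (1 - t) * ((p.1 - q.1) ^+ 2 + (p.2 - q.2) ^+ 2).
  by apply: mulr_ge0; [apply: mulr_ge0; lra | apply: addr_ge0; exact: sqr_ge0].
have : (1 - t) * power c r p <= 0 by rewrite mulr_ge0_le0 ?subr_ge0.
have : t * power c r q <= 0 by rewrite mulr_ge0_le0.
lra.
Qed.

Lemma open_disc_seg c r p q t : 0 < t <= 1 -> power c r p <= 0 -> power c r q < 0 ->
  power c r (seg p q t) < 0.
Proof.
move=> /andP[t0 t1] hp hq; rewrite power_seg_convex.
have : 0 <= t * (1 - t) * ((p.1 - q.1) ^+ 2 + (p.2 - q.2) ^+ 2).
  by apply: mulr_ge0; [apply: mulr_ge0; lra | apply: addr_ge0; exact: sqr_ge0].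
have : (1 - t) * power c r p <= 0 by rewrite mulr_ge0_le0 ?subr_ge0.
have : t * power c r q < 0 by rewrite pmulr_rlt0.
lra.
Qed.

(* When the scalar product is at least [r], [p] lies beyond the polar line of [q]
   with respect to the circle, so the segment does not enter the disc. *)
Lemma exterior_seg c r p q t : 0 < t <= 1 -> 0 <= power c r p -> 0 < power c r q ->
  r <= (p.1 - c.1) * (q.1 - c.1) + (p.2 - c.2) * (q.2 - c.2) ->
  0 < power c r (seg p q t).
Proof.
move=> /andP[t0 t1] hp hq hr; rewrite power_seg.
have : 0 <= (1 - t) ^+ 2 * power c r p by rewrite mulr_ge0 ?sqr_ge0.
have : 0 < t ^+ 2 * power c r q by rewrite mulr_gt0 ?exprn_gt0.
have : 0 <= 2 * t * (1 - t) *
    ((p.1 - c.1) * (q.1 - c.1) + (p.2 - c.2) * (q.2 - c.2) - r).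
  by apply: mulr_ge0; [apply: mulr_ge0; lra | lra].
lra.
Qed.

Lemma seg_closure A p q : (forall t, 0 < t <= 1 -> A (seg p q t)) -> closure A p.
Proof.
move=> segA B; rewrite -{1}(seg0 p q) => Bp.
have /nbhs_ballP[e /= e0 He] := seg_continuous Bp.
(* The minimum keeps [t] both at most 1 and below [e]. *)
pose t := Num.min 1 (e / 2).
have t0 : 0 < t by rewrite lt_min ltr01 divr_gt0.
exists (seg p q t); split; first by apply: segA; rewrite t0 ge_min lexx.
apply: He; rewrite /ball /= sub0r normrN gtr0_norm//.
by rewrite gt_min ltr_pdivrMr// orbC; apply/orP; left; lra.
Qed.

Lemma closed_power_le0 c r : closed [set w | power c r w <= 0].
Proof.
have -> : [set w | power c r w <= 0] = power c r @^-1` [set x | x <= 0] by [].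
by apply: closed_comp => [? _|]; [exact: power_continuous|exact: closed_le].
Qed.

Lemma closed_power_ge0 c r : closed [set w | 0 <= power c r w].
Proof.
have -> : [set w | 0 <= power c r w] = power c r @^-1` [set x | 0 <= x] by [].
by apply: closed_comp => [? _|]; [exact: power_continuous|exact: closed_ge].
Qed.

End PlaneTopology.

(** * The two sides of a circle near one of its points *)

Section CircleTopology.
Variable R : realType.
Implicit Types (c p q w z : plane R) (r s t : R) (A D N : set (plane R)).

Definition box z (e : R) : set (plane R) :=
  [set w | (- e < w.1 - z.1 < e) && (- e < w.2 - z.2 < e)].

Lemma nbhs_box z (e : R) : 0 < e -> nbhs z (box z e).
Proof.
move=> e0; apply/nbhs_ballP; exists e => //= w [].
rewrite /ball /= distrC ltr_norml => w1.
by rewrite distrC ltr_norml => w2; apply/andP; split.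
Qed.

Lemma box_nbhs z N : nbhs z N -> exists2 e : R, 0 < e & box z e `<=` N.
Proof.
move=> /nbhs_ballP[e /= e0 He]; exists e => // w /andP[w1 w2].
by apply: He; split; rewrite /ball /= distrC ltr_norml.
Qed.

Lemma box_seg z (e : R) p q t : 0 <= t <= 1 ->
  box z e p -> box z e q -> box z e (seg p q t).
Proof.
move=> /andP[t0 t1] /andP[/andP[p1 p2] /andP[p3 p4]] /andP[/andP[q1 q2] /andP[q3 q4]].
have cv (a b m : R) : a < m -> b < m -> (1 - t) * a + t * b < m.
  move=> am bm; have [tE|tN] := eqVneq t 0; first by rewrite tE; lra.
  have : (1 - t) * a <= (1 - t) * m by rewrite ler_wpM2l ?subr_ge0// ltW.
  have : t * b < t * m by rewrite ltr_pM2l// lt_def tN.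
  by lra.
have H a b (l m : R) : l < a - m < e -> l = - e -> l < b - m < e ->
    l < (1 - t) * a + t * b - m < e.
  move=> /andP[a1 a2] lE /andP[b1 b2]; apply/andP; split.
    have := cv (- a) (- b) (- m - l); rewrite !mulrN; lra.
  have := cv a b (m + e); lra.
by apply/andP; split => /=; apply: H => //; apply/andP; split.
Qed.

Lemma nbhs_power_lt c r z (a : R) : power c r z < a -> nbhs z [set w | power c r w < a].
Proof. by move=> h; exact: cvgr_lt (@power_continuous _ c r z) _ h. Qed.

(* The new centre of visibility [q] is [z] pushed slightly along the radius, and outside
   the disc [U] is cut by the polar line of [q]. *)
Lemma side_visible c r s z N : s = 1 \/ s = -1 -> 0 < r -> power c r z = 0 -> nbhs z N ->
  exists U q, [/\ U `<=` N, nbhs z U &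
    forall w t, U w -> 0 <= s * power c r w -> 0 < t <= 1 ->
      U (seg w q t) /\ 0 < s * power c r (seg w q t)].
Proof.
move=> s1 r0 hz /box_nbhs[e e0 He].
(* Since [h * m < e], a move of [z] by [h] times its radius vector stays in the box; [h <= 1 / 2]
   stops an inward move before the centre. *)
pose m : R := 1 + `|z.1 - c.1| + `|z.2 - c.2|.
have m1 : 1 <= m by rewrite /m; have := normr_ge0 (z.1 - c.1); have := normr_ge0 (z.2 - c.2); lra.
pose h := Num.min (1 / 2) (e / (2 * m)).
have h0 : 0 < h by rewrite lt_min; apply/andP; split; [lra|rewrite divr_gt0//; lra].
have h12 : h <= 1 / 2 by rewrite ge_min lexx.
have hm : h * m < e.
  have : h <= e / (2 * m) by rewrite ge_min lexx orbT.
  rewrite ler_pdivlMr; last lra.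
  by move=> ?; lra.
have hb (x : R) : 1 + `|x| <= m -> - e < h * x < e.
  move=> xm; rewrite -ltr_norml normrM (gtr0_norm h0).
  apply: le_lt_trans hm; rewrite ler_pM2l//; lra.
pose q : plane R := (z.1 + s * h * (z.1 - c.1), z.2 + s * h * (z.2 - c.2)).
have bq : box z e q.
  have h1 : - e < h * (z.1 - c.1) < e.
    by apply: hb; rewrite /m; have := normr_ge0 (z.2 - c.2); lra.
  have h2 : - e < h * (z.2 - c.2) < e.
    by apply: hb; rewrite /m; have := normr_ge0 (z.1 - c.1); lra.
  by case: s1 h1 h2 => sE /andP[h1 h1'] /andP[h2 h2'];
    rewrite /q sE /box /=; apply/andP; split; apply/andP; split; lra.
have rE : r = (z.1 - c.1) ^+ 2 + (z.2 - c.2) ^+ 2 by move: hz; rewrite /power; lra.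
have powq : power c r q = ((1 + s * h) ^+ 2 - 1) * r by rewrite /power /= rE; ring.
(* Inside the disc convexity suffices, and the box itself serves as [U]. *)
case: s1 => sE; rewrite sE in powq *; last first.
  have q0 : power c r q < 0.
    have -> : power c r q = - (h * (2 - h) * r) by rewrite powq; ring.
    by rewrite oppr_lt0 !mulr_gt0//; lra.
  exists (box z e), q; split => // [|w t bw wr tt]; first exact: nbhs_box.
  split; first by apply: box_seg => //; case/andP: tt => t0 ->; rewrite ltW.
  by rewrite mulN1r oppr_gt0; apply: open_disc_seg => //; lra.
have q0 : 0 < power c r q.
  have -> : power c r q = h * (2 + h) * r by rewrite powq; ring.
  by rewrite !mulr_gt0//; lra.
pose dot w : R := (w.1 - c.1) * (q.1 - c.1) + (w.2 - c.2) * (q.2 - c.2).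
have dotq : r < dot q.
  by move: q0; rewrite /power /dot !expr2; lra.
have dotz : r < dot z.
  have -> : dot z = r + h * r by rewrite /dot /q sE rE /=; ring.
  by rewrite ltrDl mulr_gt0.
have dotC : continuous dot.
  move=> w; have c1 := @fst_continuous R w; have c2 := @snd_continuous R w.
  by apply: cvgD; apply: cvgM; try (exact: cvg_cst); apply: cvgD => //; exact: cvg_cst.
exists (box z e `&` [set w | r < dot w]), q; split.
- by move=> w [/He].
- by apply: filterI; [exact: nbhs_box | exact: cvgr_gt (dotC z) _ dotz].
move=> w t [bw dw]; rewrite !mul1r => wr tt; split; last first.
  by apply: exterior_seg => //; exact: ltW.
split; first by apply: box_seg => //; case/andP: tt => t0 ->; rewrite ltW.
case/andP: tt => t0 t1 /=.
have -> : dot (seg w q t) = (1 - t) * dot w + t * dot q by rewrite /dot /=; ring.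
have : 0 <= (1 - t) * (dot w - r) by rewrite mulr_ge0// subr_ge0// ltW.
have : 0 < t * (dot q - r) by rewrite mulr_gt0// subr_gt0.
lra.
Qed.

Lemma component_sub (T : topologicalType) (B E F : set T) :
  is_component B E -> connected F -> F `<=` B -> F `&` E !=set0 -> F `<=` E.
Proof.
move=> [x Bx ->] cF FB [y [Fy Exy]].
rewrite (same_connected_component Exy).
exact: connected_component_max.
Qed.

(** The part of a visible neighbourhood [U] on the open side is star-shaped about [q], hence
    connected, and it meets [D] because [z] is in the closure; so it lies in [D]. Any point of [U]
    on the closed side is the end of a segment whose other points are in that part. *)
Lemma near_smooth_boundary N D c r s z : s = 1 \/ s = -1 -> 0 < r ->
  is_component N D -> closure D z -> power c r z = 0 ->
  (forall w, D w -> 0 < s * power c r w) ->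
  (\forall w \near z, 0 < s * power c r w -> N w) ->
  \forall w \near z, 0 <= s * power c r w -> closure D w.
Proof.
move=> s1 r0 ND clz hz sD sN.
have [U [q [UN zU Uq]]] := side_visible s1 r0 hz sN.
pose B := U `&` [set w | 0 < s * power c r w].
have BD : B `<=` D.
  apply: (component_sub ND).
  - apply: (@star_connected _ _ q) => p t [Up sp] /andP[t0 t1].
    have [->|tN] := eqVneq t 0; first by rewrite seg0.
    by apply: Uq => //; [exact: ltW | rewrite t1 lt_def tN t0].
  - by move=> w [/UN]; exact.
  - have [w [Dw Uw]] := clz _ zU.
    by exists w; split => //; split => //; exact: sD.
apply: filterS zU => w Uw sw; apply: (@seg_closure _ _ _ q) => t tt.
by apply: BD; have [] := Uq w t Uw sw tt.
Qed.

End CircleTopology.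

(** * Connectedness of arcs and discs *)

Section Caps.
Variable R : realType.
Implicit Types (c e k w z : plane R) (r m : R).

Definition circ c r : set (plane R) :=
  [set z | (z.1 - c.1) ^+ 2 + (z.2 - c.2) ^+ 2 = r].

Lemma circE c r z : circ c r z <-> power c r z = 0.
Proof. by rewrite /circ /power /=; split=> [->|]; [rewrite subrr | lra]. Qed.

Definition cap c r e m : set (plane R) :=
  circ c r `&` [set w | m <= (w.1 - c.1) * e.1 + (w.2 - c.2) * e.2].

(** A point of the circle is determined by its scalar product [a] with [e] and by a sign [s]: its
    component orthogonal to [e] is given by [s * h a]. The cap is thus the union of two continuous
    images of the interval [I], which share the point where [a] is the square root of [n * r] and
    [h] vanishes. *)
Lemma cap_connected_aux c r e m : 0 < e.1 ^+ 2 + e.2 ^+ 2 -> connected (cap c r e m).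
Proof.
set n := _ + _ => n0.
have nN0 : n != 0 by rewrite gt_eqF.
pose I : set R := [set a | m <= a /\ a ^+ 2 <= n * r].
pose h (a : R) : R := Num.sqrt (n * r - a ^+ 2).
pose f (s : R) (a : R) : plane R :=
  (c.1 + (a * e.1 + s * h a * e.2) / n, c.2 + (a * e.2 - s * h a * e.1) / n).
have cap0 : cap c r e m !=set0 -> 0 <= n * r /\ I (Num.sqrt (n * r)).
  move=> [w [/= cw mw]].
  have nr0 : 0 <= n * r by rewrite -cw mulr_ge0 ?(ltW n0) ?addr_ge0 ?sqr_ge0.
  split=> //; split; last by rewrite sqr_sqrtr.
  (* This is the Cauchy-Schwarz inequality, obtained from Lagrange's identity. *)
  apply: (le_trans mw); apply: (le_trans (ler_norm _)); rewrite -sqrtr_sqr ler_wsqrtr//.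
  rewrite -cw /n; set x := w.1 - c.1; set y := w.2 - c.2.
  have := sqr_ge0 (x * e.2 - y * e.1); lra.
have [/cap0[nr0 Imax]|capE] := pselect (cap c r e m !=set0); last first.
  have -> : cap c r e m = set0 by apply/seteqP; split => // w Hw; apply: capE; exists w.
  exact: connected0.
have fcap s a : s = 1 \/ s = -1 -> I a -> cap c r e m (f s a).
  move=> s1 [ma na]; rewrite /cap /circ /f /=.
  have sh : (s * h a) ^+ 2 = n * r - a ^+ 2.
    rewrite exprMn /h sqr_sqrtr ?subr_ge0//.
    by have -> : s ^+ 2 = 1; [case: s1 => ->; ring | rewrite mul1r].
  split => /=; last first.
    suff -> : (c.1 + (a * e.1 + s * h a * e.2) / n - c.1) * e.1 +
       (c.2 + (a * e.2 - s * h a * e.1) / n - c.2) * e.2 = a by [].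
    by rewrite /n in nN0 *; field.
  have -> : (c.1 + (a * e.1 + s * h a * e.2) / n - c.1) ^+ 2 +
     (c.2 + (a * e.2 - s * h a * e.1) / n - c.2) ^+ 2 =
     (a ^+ 2 + (s * h a) ^+ 2) / n by rewrite /n in nN0 *; field.
  by rewrite sh; field.
have -> : cap c r e m = (f 1 @` I) `|` (f (-1) @` I).
  apply/seteqP; split => [w [cw mw]|w]; last first.
    by case=> -[a Ia <-]; apply: fcap => //; [left|right].
  rewrite /circ /= in cw mw.
  set a := _ + _ in mw.
  pose b := (w.1 - c.1) * e.2 - (w.2 - c.2) * e.1.
  have ab : a ^+ 2 + b ^+ 2 = n * r by rewrite -cw /a /b /n; ring.
  have ha : h a = `|b| by rewrite /h -sqrtr_sqr; congr Num.sqrt; rewrite -ab; ring.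
  have Ia : I a by split => //; rewrite -ab; have := sqr_ge0 b; lra.
  have wf s : s * `|b| = b -> f s a = w.
    move=> sb; rewrite /f ha sb [RHS]surjective_pairing.
    by congr pair; rewrite /a /b /n in nN0 *; field.
  have [b0|b0] := leP 0 b; [left|right]; exists a => //; apply: wf.
    by rewrite ger0_norm// mul1r.
  by rewrite ltr0_norm// mulN1r opprK.
have cI : connected I.
  apply/connected_intervalP => a b [ma na] [mb nb] x /andP[ax xb]; split; first lra.
  have [x0|x0] := leP 0 x.
    by apply: le_trans nb; rewrite ler_sqr ?nnegrE//; lra.
  by apply: le_trans na; rewrite -sqrrN -[leRHS]sqrrN ler_sqr ?nnegrE//; lra.
have hC : continuous h.
  move=> a; apply: (@continuous_comp _ _ _ (fun a : R => n * r - a ^+ 2) Num.sqrt).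
    apply: cvgB; first exact: cvg_cst.
    exact: (@exprn_continuous R 2).
  exact: sqrt_continuous.
have fC s : continuous (f s).
  have lin (x y u : R) : continuous (fun a : R => x + (a * y + s * h a * u) / n).
    move=> a; apply: cvgD; first exact: cvg_cst.
    apply: cvgM; last exact: cvg_cst.
    apply: cvgD; first by apply: cvgM; [exact: cvg_id|exact: cvg_cst].
    by apply: cvgM; [apply: cvgM; [exact: cvg_cst|exact: hC]|exact: cvg_cst].
  apply: pair_continuous; first exact: lin.
  rewrite (_ : (fun _ => _) = fun a => c.2 + (a * e.2 + s * h a * - e.1) / n); first exact: lin.
  by apply/funext => a; rewrite mulrN.
apply: connectedU.
- have h0 : h (Num.sqrt (n * r)) = 0 by rewrite /h sqr_sqrtr// subrr sqrtr0.
  exists (f 1 (Num.sqrt (n * r))); split; first by exists (Num.sqrt (n * r)).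
  by exists (Num.sqrt (n * r)) => //; rewrite /f h0 !mulr0 !mul0r.
- by apply: connected_continuous_connected => //; exact: continuous_subspaceT.
- by apply: connected_continuous_connected => //; exact: continuous_subspaceT.
Qed.

Lemma circ_connected c r : connected (circ c r).
Proof.
(* The bound excludes nothing: on the circle the first coordinate relative to the centre has square
   at most [r]. *)
have -> : circ c r = cap c r (1, 0) (- (`|r| + 1)).
  apply/seteqP; split=> [w cw|w []//]; split => //=.
  rewrite mulr1 mulr0 addr0; move: cw; rewrite /circ /= => cw.
  have := ler_norm r; have := normr_ge0 r; have := sqr_ge0 (w.2 - c.2).
  set x := w.1 - c.1 in cw *; nra.
apply: cap_connected_aux => /=; lra.
Qed.

(** When [e] is null the linear condition reads [m <= 0], so the cap is the whole circle or
    empty. *)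
Lemma cap_connected c r e m : connected (cap c r e m).
Proof.
have [n0|] := ltP 0 (e.1 ^+ 2 + e.2 ^+ 2); first exact: cap_connected_aux.
have := sqr_ge0 e.1; have := sqr_ge0 e.2 => e20 e10 e0.
have /eqP : e.1 ^+ 2 = 0 by lra.
rewrite expf_eq0 /= => /eqP e1.
have /eqP : e.2 ^+ 2 = 0 by lra.
rewrite expf_eq0 /= => /eqP e2.
have [m0|m0] := leP m 0.
  have -> : cap c r e m = circ c r.
    apply/seteqP; split=> [w []//|w cw]; split => //=.
    by rewrite e1 e2 !mulr0 addr0.
  exact: circ_connected.
have -> : cap c r e m = set0.
  apply/seteqP; split => // w [_ /=].
  by rewrite e1 e2 !mulr0 addr0 => /(lt_le_trans m0); rewrite ltxx.
exact: connected0.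
Qed.

Definition disc k r : set (plane R) := [set w | power k r w <= 0].

(** Subtracting the equation of the circle from the inequality of the disc leaves a linear
    inequality, whose border is the radical axis; the intersection is a cap. *)
Lemma circI_disc_connected c r k s : connected (circ c r `&` disc k s).
Proof.
have -> : circ c r `&` disc k s =
    cap c r (k.1 - c.1, k.2 - c.2)
      (((c.1 - k.1) ^+ 2 + (c.2 - k.2) ^+ 2 + r - s) / 2).
  apply/seteqP; split => w [cw dw]; split => //=; move: cw dw;
  by rewrite /circ /disc /power /= => <-; lra.
exact: cap_connected.
Qed.

Lemma disc_connected k r : connected (disc k r).
Proof.
have [[q dq]|nd] := pselect (disc k r !=set0).
  by apply: (@star_connected _ _ q) => p t dp tt; exact: disc_seg.
have -> : disc k r = set0 by apply/seteqP; split => // w Hw; apply: nd; exists w.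
exact: connected0.
Qed.

Lemma disc_closed k r : closed (disc k r).
Proof. exact: closed_power_le0. Qed.

End Caps.

(** Topological core of the count of double points: [K] stands for the disc, [X] for the part of the
    closed domain in it, and [g C] for an equation of [C] that is nonnegative on [X]. The last two
    hypotheses say that, near a point of [B], the set [X] is all of [K] or one closed side of a
    curve in [K]. *)
Lemma clopen_sides (R : realType) (T : topologicalType) (K X B : set T)
    (S : set (set T)) (g : set T -> T -> R) :
  connected K -> closed X -> X `<=` K -> finite_set S ->
  (forall C, S C -> continuous (g C)) ->
  (forall C, S C -> C = [set z | g C z = 0]) ->
  (forall C, S C -> connected (C `&` K)) ->
  (forall C z, S C -> X z -> 0 <= g C z) ->
  B !=set0 -> (exists2 U, open U & B = X `&` U) ->
  (exists2 F, closed F & B = X `&` F) ->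
  (forall z, B z -> (forall C, S C -> ~ C z) -> \forall w \near z, K w -> X w) ->
  (forall z C, B z -> S C -> C z ->
     \forall w \near z, K w -> 0 <= g C w -> X w) ->
  B = X.
Proof.
move=> cK clX XK finS gC SE SK Xg B0 [U oU BU] [F cF BF] Bint Bbd.
have BX : B `<=` X by rewrite BU => z [].
have clB : closed B by rewrite BF; exact: closedI.
have nU z : B z -> nbhs z U.
  by rewrite BU => -[_ Uz]; move: oU; rewrite openE; exact.
(* The trace of [B] on the connected set formed by [C] in [K] is open and closed there: along [C]
   the function [g C] is zero, so nearby points of [C] in [K] belong to [X]. *)
have CKB C : S C -> C `&` B !=set0 -> C `&` K `<=` B.
  move=> SC CB0.
  suff <- : C `&` B = C `&` K by move=> z [].
  apply: (SK C SC).
  - by have [z [Cz Bz]] := CB0; exists z.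
  (* The interior of an implication turns a neighbourhood statement relative to [K] into a genuine
     open set. *)
  - exists (interior [set w | K w -> 0 <= g C w -> B w]); first exact: open_interior.
    apply/seteqP; split => [z [Cz Bz]|z [[Cz Kz] /interior_subset /= Bz]]; last first.
      split => //; apply: Bz => //.
      by move: Cz; rewrite {1}(SE _ SC) /= => ->.
    split; first by split => //; exact/XK/BX.
    apply: filterS2 (nU z Bz) (Bbd z C Bz SC Cz) => w Uw h Kw gw.
    by rewrite BU; split => //; exact: h.
  - exists B => //; apply/seteqP; split => [z [Cz Bz]|z [[Cz Kz] Bz]] //.
    by split => //; split => //; exact/XK/BX.
pose SB := [set C | S C /\ C `&` B !=set0].
pose G := B `|` \bigcup_(C in SB) [set w | g C w <= 0].
have clG : closed G.
  apply: closedU => //; apply: closed_bigcup.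
    by apply: sub_finite_set finS => C [].
  move=> C [SC _]; have -> : [set w | g C w <= 0] = g C @^-1` [set x | x <= 0] by [].
  by apply: closed_comp => [? _|]; [exact: gC|exact: closed_le].
have GK : K `&` G = K.
  apply: cK.
  - by have [z Bz] := B0; exists z; split; [exact/XK/BX|left].
  - exists (interior [set w | K w -> G w]); first exact: open_interior.
    apply/seteqP; split => [z [Kz Gz]|z [Kz /interior_subset /= Gz]]; last first.
      by split => //; exact: Gz.
    split => //; rewrite /interior /=.
    (* Across a curve [C] through [y], the side [g C > 0] is covered by [B] and the other one by the
       piece added for [C]. *)
    have nearB y : B y -> \forall w \near y, K w -> G w.
      move=> By; have [[C [SC Cy]]|nC] := pselect (exists C, S C /\ C y).
        apply: filterS2 (nU y By) (Bbd y C By SC Cy) => w Uw h Kw.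
        have [gw|gw] := leP 0 (g C w); last first.
          by right; exists C; [split => //; exists y | exact: ltW].
        by left; rewrite BU; split => //; exact: h.
      have nC' C : S C -> ~ C y by move=> SC Cy; apply: nC; exists C.
      apply: filterS2 (nU y By) (Bint y By nC') => w Uw h Kw.
      by left; rewrite BU; split => //; exact: h.
    case: Gz => [|[C SBC /= gz]]; first exact: nearB.
    move: gz; rewrite le_eqVlt => /orP[/eqP gz|gz].
      apply: nearB; have [SC CB0] := SBC; apply: (CKB C) => //; split => //.
      by rewrite (SE _ SC).
    have near_lt : \forall w \near z, g C w < 0.
      exact: cvgr_lt (gC C SBC.1 z) _ gz.
    have ltG : [set w | g C w < 0] `<=` [set w | K w -> G w].
      by move=> w gw Kw; right; exists C => //; exact: ltW.
    exact: filterS ltG near_lt.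
  - by exists G.
(* A point of [X] in an added piece satisfies [g C z = 0], so it lies on a curve meeting [B], and
   [CKB] puts it in [B]. *)
apply/seteqP; split => // z Xz.
have Kz := XK _ Xz; have [_ [//|[C [SC CB0] /= gz]]] : (K `&` G) z by rewrite GK.
apply: (CKB C) => //; split => //; rewrite (SE _ SC) /=.
by apply/eqP; rewrite eq_le gz Xg.
Qed.

(** * Circles as algebraic curves *)

Section Polynomials.
Variable R : realType.
Implicit Types (f g : poly2 R) (c p v z : plane R) (r : R).

Definition eval_at z f : R := meval (fun i => coord i z) f.

Lemma differentialE f p v :
  differential f p v = eval_at p (mderiv ord0 f) * v.1 + eval_at p (mderiv ord_max f) * v.2.
Proof.
rewrite /differential big_ord_recl big_ord1.
by have -> : lift ord0 ord0 = ord_max :> 'I_2 by apply: val_inj.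
Qed.

Lemma differentialD f g p v :
  differential (f + g) p v = differential f p v + differential g p v.
Proof. by rewrite !differentialE !mderivD /eval_at !mevalD; ring. Qed.

Lemma differentialM f g p v : differential (f * g) p v =
  eval_at p f * differential g p v + eval_at p g * differential f p v.
Proof. by rewrite !differentialE !mderivM /eval_at !mevalD !mevalM; ring. Qed.

Lemma differentialC (a : R) p v : differential (mpolyC 2 a) p v = 0.
Proof. by rewrite differentialE !mderivC /eval_at !raddf0 !mul0r addr0. Qed.

Lemma mderivXU (i j : 'I_2) :
  mderiv i (mpolyX R (mnm1 j)) = mpolyC 2 (i == j)%:R.
Proof.
rewrite mderivX mnm1E eq_sym; have [->|_] := eqVneq i j; last by rewrite scale0r mpolyC0.
rewrite scale1r mpolyC1 -mpolyX0; congr (mpolyX R _).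
by apply/mnmP => k; rewrite mnmBE mnm0E subnn.
Qed.

Lemma differentialX (i : 'I_2) p v : differential (mpolyX R (mnm1 i)) p v = coord i v.
Proof.
rewrite differentialE !mderivXU /eval_at !mevalC /coord.
have [->|->] : i = ord0 \/ i = ord_max.
  by case: i => -[|[|//]] ?; [left|right]; exact: val_inj.
all: by rewrite /=; ring.
Qed.

(** Polynomials as the ring generated by constants and variables, so that the chain rule reduces to
    the sum and product rules. *)
Lemma mpoly_ring_ind (P : poly2 R -> Prop) :
  (forall a, P (mpolyC 2 a)) -> (forall i, P (mpolyX R (mnm1 i))) ->
  (forall f g, P f -> P g -> P (f + g)) -> (forall f g, P f -> P g -> P (f * g)) ->
  forall f, P f.
Proof.
move=> PC PX PD PM; elim/mpolyind => [|a m f _ _ Pf]; first by rewrite -(mpolyC0 2 R).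
apply: (PD) => //; rewrite -mul_mpolyC; apply: (PM) => //.
rewrite mpolyXE_id; apply: (big_ind P) => [||i _]; [by rewrite -(mpolyC1 2 R) | exact: PM |].
elim: (m i) => [|k Pk]; first by rewrite expr0 -(mpolyC1 2 R).
by rewrite exprS; exact: PM.
Qed.

Lemma is_derive_eval (a b : R -> R) (t a' b' : R) f :
  is_derive t 1 a a' -> is_derive t 1 b b' ->
  is_derive t 1 (fun s => eval_at (a s, b s) f) (differential f (a t, b t) (a', b')).
Proof.
move=> da db; elim/mpoly_ring_ind : f => [x|i|f g df dg|f g df dg].
- rewrite differentialC (_ : (fun _ => _) = cst x); first exact: is_derive_cst.
  by apply/funext => s; rewrite /eval_at mevalC.
- rewrite differentialX (_ : (fun _ => _) = if i == ord0 then a else b).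
    by rewrite /coord; case: ifP.
  by apply/funext => s; rewrite /eval_at mevalXU /coord; case: ifP.
- rewrite differentialD (_ : (fun _ => _) =
    (fun s => eval_at (a s, b s) f) + (fun s => eval_at (a s, b s) g)).
    exact: is_deriveD.
  by apply/funext => s; rewrite /eval_at mevalD.
- rewrite differentialM (_ : (fun _ => _) =
    (fun s => eval_at (a s, b s) f) * (fun s => eval_at (a s, b s) g)).
    exact: is_deriveM.
  by apply/funext => s; rewrite /eval_at mevalM.
Qed.

(* Differentiates [f] along the parametrization of the circle by rotations. *)
Lemma differential_tangent f c r p :
  circ c r `<=` zero_set f -> circ c r p ->
  differential f p (- (p.2 - c.2), p.1 - c.1) = 0.
Proof.
move=> cf cp; set x := p.1 - c.1; set y := p.2 - c.2.
pose a (t : R) := c.1 + (x * cos t - y * sin t).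
pose b (t : R) := c.2 + (y * cos t + x * sin t).
have da : is_derive (0 : R) 1 a (- y).
  rewrite /a; apply: is_derive_eq.
  by rewrite sin0 cos0 /GRing.scale /=; ring.
have db : is_derive (0 : R) 1 b x.
  rewrite /b; apply: is_derive_eq.
  by rewrite sin0 cos0 /GRing.scale /=; ring.
have := is_derive_eval f da db.
have -> : (fun s => eval_at (a s, b s) f) = cst 0.
  apply/funext => s; apply: cf; rewrite /circ /a /b /= -cp /x /y.
  by have := cos2Dsin2 s; set C := cos s; set s' := sin s => cs;
    rewrite -[RHS]mul1r -cs; ring.
have -> : (a 0, b 0) = p.
  by rewrite /a /b cos0 sin0 [RHS]surjective_pairing /x /y; congr pair; ring.
move=> h; have := @derive_val _ _ _ _ _ _ _ h.
by rewrite derive_cst.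
Qed.

Definition circle_poly c r : poly2 R :=
  (mpolyX R (mnm1 ord0) - mpolyC 2 c.1) * (mpolyX R (mnm1 ord0) - mpolyC 2 c.1) +
  (mpolyX R (mnm1 ord_max) - mpolyC 2 c.2) * (mpolyX R (mnm1 ord_max) - mpolyC 2 c.2) +
  mpolyC 2 (- r).

Lemma eval_circle_poly c r z : eval_at z (circle_poly c r) = power c r z.
Proof.
rewrite /eval_at /circle_poly !mevalD !mevalM !mevalB !mevalXU !mevalC /coord /power /=.
ring.
Qed.

Lemma differential_circle_poly c r p v : differential (circle_poly c r) p v =
  2 * ((p.1 - c.1) * v.1 + (p.2 - c.2) * v.2).
Proof.
rewrite /circle_poly -!mpolyCN !differentialD !differentialM !differentialC.
rewrite !differentialD !differentialX !differentialC /eval_at !mevalD !mevalXU !mevalC.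
by rewrite /coord /=; ring.
Qed.

Lemma zero_set_circle_poly c r : zero_set (circle_poly c r) = circ c r.
Proof.
apply/seteqP; split=> z; rewrite /zero_set /= -/(eval_at z _) eval_circle_poly.
  by move/circE.
by move=> /circE.
Qed.

Lemma circ_neq_center c r p : 0 < r -> circ c r p ->
  0 < (p.1 - c.1) ^+ 2 + (p.2 - c.2) ^+ 2.
Proof. by move=> r0; rewrite /circ /= => ->. Qed.

Lemma circ_nonempty c r : 0 < r -> circ c r (c.1 + Num.sqrt r, c.2).
Proof.
by move=> r0; rewrite /circ /= addrAC subrr add0r subrr sqr_sqrtr ?ltW// expr0n addr0.
Qed.

Lemma nonsingular_circle_poly c r : 0 < r ->
  nonsingular_component (circle_poly c r) (circ c r).
Proof.
move=> r0; split.
  exists (c.1 + Num.sqrt r, c.2); rewrite zero_set_circle_poly.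
    exact: circ_nonempty.
  rewrite connected_component_id//; first exact: circ_nonempty.
  exact: circ_connected.
(* Along the radius vector the differential is twice the squared radius. *)
move=> p /(circ_neq_center r0) p0 /(_ (p.1 - c.1, p.2 - c.2)).
by rewrite differential_circle_poly /= -!expr2; lra.
Qed.

Lemma circ_curve c r : 0 < r -> curve (circ c r).
Proof. by move=> r0; exists (circle_poly c r); exact: nonsingular_circle_poly. Qed.

(** Any defining polynomial may witness the tangency. Its gradient at [p] is orthogonal to [v] and
    to the rotated radius; if [v] were not orthogonal to the radius, these two vectors would be
    independent, with determinant [d], and [p] would be singular. *)
Lemma tangent_circ c r p v : 0 < r -> circ c r p ->
  tangent_space (circ c r) p v <-> (p.1 - c.1) * v.1 + (p.2 - c.2) * v.2 = 0.
Proof.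
move=> r0 cp; split => [[f [[x fx Ex] nsf] fv]|h]; last first.
  exists (circle_poly c r); first exact: nonsingular_circle_poly.
  by rewrite differential_circle_poly h mulr0.
have cf : circ c r `<=` zero_set f by rewrite Ex; exact: connected_component_sub.
have := differential_tangent cf cp; move: fv; rewrite !differentialE /=.
set A := eval_at p _; set B := eval_at p _ => fv ft.
apply: contrapT => h0; apply: (nsf _ cp) => u; rewrite differentialE -/A -/B.
have n0 := circ_neq_center r0 cp.
set d := _ + _ in h0; have d0 : d != 0 by apply/eqP.
have A0 : A * d = 0.
  have -> : A * d = (A * v.1 + B * v.2) * (p.1 - c.1) +
      (A * - (p.2 - c.2) + B * (p.1 - c.1)) * - v.2.
    by rewrite /d; ring.
  by rewrite fv ft; ring.
have B0 : B * d = 0.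
  have -> : B * d = (A * v.1 + B * v.2) * (p.2 - c.2) +
      (A * - (p.2 - c.2) + B * (p.1 - c.1)) * v.1.
    by rewrite /d; ring.
  by rewrite fv ft; ring.
move/eqP: A0; rewrite mulf_eq0 (negbTE d0) orbF => /eqP ->.
move/eqP: B0; rewrite mulf_eq0 (negbTE d0) orbF => /eqP ->.
by ring.
Qed.

Lemma transversal_circ c1 r1 c2 r2 p : 0 < r1 -> 0 < r2 -> circ c1 r1 p -> circ c2 r2 p ->
  (p.1 - c1.1) * (p.2 - c2.2) - (p.2 - c1.2) * (p.1 - c2.1) != 0 ->
  transversal (circ c1 r1) (circ c2 r2) p.
Proof.
move=> r10 r20 cp1 cp2.
set x1 := p.1 - c1.1; set y1 := p.2 - c1.2; set x2 := p.1 - c2.1; set y2 := p.2 - c2.2.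
set d := _ - _ => d0 w.
(* Cramer's rule for [w] in the basis of the two rotated radii, of determinant [d]. *)
pose l := (x2 * w.1 + y2 * w.2) / d; pose m := - (x1 * w.1 + y1 * w.2) / d.
exists (- y1 * l, x1 * l), (- y2 * m, x2 * m); split.
- by apply/tangent_circ => //=; rewrite -/x1 -/y1; ring.
- by apply/tangent_circ => //=; rewrite -/x2 -/y2; ring.
- rewrite [LHS]surjective_pairing; congr pair; rewrite /= /l /m;
  by rewrite /d in d0 *; field.
Qed.

(** The measure is the degree plus one, so every monomial is constant or a single variable. *)
Lemma eval_affine f p q t : (mmeasure mdeg f <= 2)%N ->
  eval_at (seg p q t) f = (1 - t) * eval_at p f + t * eval_at q f.
Proof.
move=> f2; rewrite [f]mpolyE /eval_at !raddf_sum !mulr_sumr -big_split /=.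
rewrite !big_seq; apply: eq_bigr => m mf; rewrite !mevalZ.
have m1 : (mdeg m < 2)%N := leq_trans (msize_mdeg_lt mf) f2.
have [m0|mN0] := eqVneq (mdeg m) 0%N.
  move/eqP: m0; rewrite mdeg_eq0 => /eqP ->; rewrite mpolyX0 !meval1; ring.
have /mdeg1P[i /eqP ->] : mdeg m == 1%N by case: (mdeg m) m1 mN0 => [|[|]].
by rewrite !mevalXU /coord; case: ifP => _ /=; ring.
Qed.

(** A polynomial of degree one vanishing at two opposite points would vanish at their midpoint, the
    centre, which is not on the circle. *)
Lemma circ_not_line c r : 0 < r -> ~ straight_line (circ c r).
Proof.
move=> r0 [f f2 cf].
have cN : circ c r (c.1 - Num.sqrt r, c.2).
  by rewrite /circ /= addrAC subrr add0r subrr sqrrN sqr_sqrtr ?ltW// expr0n addr0.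
have : circ c r (seg (c.1 + Num.sqrt r, c.2) (c.1 - Num.sqrt r, c.2) (1 / 2)).
  have := circ_nonempty c r0; move: cN; rewrite cf /zero_set /= -!/(eval_at _ _) => h1 h2.
  by rewrite eval_affine ?f2// h1 h2 !mulr0 addr0.
have -> : seg (c.1 + Num.sqrt r, c.2) (c.1 - Num.sqrt r, c.2) (1 / 2) = c.
  by rewrite /seg /= [RHS]surjective_pairing; congr pair; field.
by rewrite /circ /= !subrr; lra.
Qed.

End Polynomials.

(** * Infinite sets and sets with two elements *)

Section Cardinals.
Variable T : Type.
Implicit Types A : set T.

Lemma infinite_setD1 A a : infinite_set A -> infinite_set (A `\ a).
Proof.
move=> infA finA; apply: infA; apply: (@sub_finite_set _ _ ((A `\ a) `|` [set a])).
  by move=> x Ax; have [->|xa] := pselect (x = a); [right|left].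
by rewrite finite_setU; split => //; exact: finite_set1.
Qed.

Lemma two_le_card A a b : A a -> A b -> a <> b -> `I_2 #<= A.
Proof.
move=> Aa Ab ab; pose f (n : nat) : T := if n is 0%N then a else b.
have fI : {in `I_2 &, injective f}.
  move=> m n; rewrite !inE /=.
  by case: m => [|[|m]]; case: n => [|[|n]] //= _ _ e; case: ab.
apply: (@card_le_trans _ _ _ (f @` `I_2)).
  by have := inj_card_eq fI; rewrite card_eq_le => /andP[].
by apply: subset_card_le => _ [[|[|//]] _ <-].
Qed.

End Cardinals.

(** * Intersections of circles *)

Section CircleFamilies.
Variable R : realType.
Implicit Types (c k p w z : plane R) (r s : R) (S : set (set (plane R))).
Implicit Types (A C D : set (plane R)).

Lemma circ_closed c r : closed (circ c r).
Proof.
have -> : circ c r = [set w | power c r w <= 0] `&` [set w | 0 <= power c r w].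
  apply/seteqP; split => [w /circE /= ->|w [/= le0 ge0]]; first by rewrite lexx.
  by apply/circE/eqP; rewrite eq_le le0.
apply: closedI; [exact: closed_power_le0 | exact: closed_power_ge0].
Qed.

Lemma circ_infinite c r : 0 < r -> infinite_set (circ c r).
Proof.
move=> r0.
pose x (n : nat) : R := Num.sqrt r / n.+1%:R.
pose f (n : nat) : plane R := (c.1 + x n, c.2 + Num.sqrt (r - x n ^+ 2)).
have fI : injective f.
  move=> m n [/addrI /(mulfI (lt0r_neq0 _))]; rewrite sqrtr_gt0 => /(_ r0).
  by move/invr_inj/eqP; rewrite eqr_nat => /eqP[].
apply/infiniteP/(@card_le_trans _ _ _ (range f)).
  have : {in [set: nat] &, injective f} by move=> m n _ _; exact: fI.
  by move/inj_card_eq; rewrite card_eq_le => /andP[].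
apply: subset_card_le.
move=> _ [n _ <-]; rewrite /circ /f /= [c.1 + _]addrC addrK [c.2 + _]addrC addrK.
rewrite sqr_sqrtr; first by ring.
rewrite subr_ge0 /x exprMn sqr_sqrtr ?(ltW r0)// ler_piMr ?(ltW r0)//.
by rewrite exprVn invf_le1 ?exprn_gt0// -natrX ler1n expn_gt0.
Qed.

(** The difference [e] of the centres is orthogonal to the chords [u] and [v] from [p]. If [e] is
    not null, then [v = l * u], and the chord equation of the first circle gives [l = 0] or [l = 1],
    so [w] is [p] or [q]. Hence the centres agree, and [p] fixes the radius. *)
Lemma circ_three c r c' r' p q w : p <> q -> p <> w -> q <> w ->
  (circ c r `&` circ c' r') p -> (circ c r `&` circ c' r') q ->
  (circ c r `&` circ c' r') w -> circ c r = circ c' r'.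
Proof.
move=> pq pw qw [cp cp'] [cq cq'] [cw cw'].
rewrite /circ /= in cp cp' cq cq' cw cw'.
set a1 := p.1 - c.1 in cp; set a2 := p.2 - c.2 in cp.
set u1 := q.1 - p.1; set u2 := q.2 - p.2; set v1 := w.1 - p.1; set v2 := w.2 - p.2.
set e1 := c'.1 - c.1; set e2 := c'.2 - c.2.
have au : u1 ^+ 2 + u2 ^+ 2 + 2 * (u1 * a1 + u2 * a2) = 0.
  have -> : u1 ^+ 2 + u2 ^+ 2 + 2 * (u1 * a1 + u2 * a2) =
    (q.1 - c.1) ^+ 2 + (q.2 - c.2) ^+ 2 - (a1 ^+ 2 + a2 ^+ 2).
    by rewrite /u1 /u2 /a1 /a2; ring.
  by rewrite cp cq subrr.
have av : v1 ^+ 2 + v2 ^+ 2 + 2 * (v1 * a1 + v2 * a2) = 0.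
  have -> : v1 ^+ 2 + v2 ^+ 2 + 2 * (v1 * a1 + v2 * a2) =
    (w.1 - c.1) ^+ 2 + (w.2 - c.2) ^+ 2 - (a1 ^+ 2 + a2 ^+ 2).
    by rewrite /v1 /v2 /a1 /a2; ring.
  by rewrite cp cw subrr.
have eu : e1 * u1 + e2 * u2 = 0.
  have -> : e1 * u1 + e2 * u2 =
    (((q.1 - c.1) ^+ 2 + (q.2 - c.2) ^+ 2) - (a1 ^+ 2 + a2 ^+ 2)
     - ((q.1 - c'.1) ^+ 2 + (q.2 - c'.2) ^+ 2) +
       ((p.1 - c'.1) ^+ 2 + (p.2 - c'.2) ^+ 2)) / 2.
    by rewrite /e1 /e2 /u1 /u2 /a1 /a2; field.
  by rewrite cp cq cp' cq'; lra.
have ev : e1 * v1 + e2 * v2 = 0.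
  have -> : e1 * v1 + e2 * v2 =
    (((w.1 - c.1) ^+ 2 + (w.2 - c.2) ^+ 2) - (a1 ^+ 2 + a2 ^+ 2)
     - ((w.1 - c'.1) ^+ 2 + (w.2 - c'.2) ^+ 2) +
       ((p.1 - c'.1) ^+ 2 + (p.2 - c'.2) ^+ 2)) / 2.
    by rewrite /e1 /e2 /v1 /v2 /a1 /a2; field.
  by rewrite cp cw cp' cw'; lra.
have uN0 : u1 ^+ 2 + u2 ^+ 2 != 0.
  rewrite paddr_eq0 ?sqr_ge0// !sqrf_eq0 !subr_eq0; apply/negP => /andP[/eqP h1 /eqP h2].
  by apply: pq; rewrite [LHS]surjective_pairing [RHS]surjective_pairing h1 h2.
have eN0 : e1 ^+ 2 + e2 ^+ 2 == 0.
  apply: contraT => eN0.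
  have uv : u1 * v2 - u2 * v1 = 0.
    apply/eqP; rewrite -(mulrI_eq0 _ (mulfI eN0)).
    have -> : (e1 ^+ 2 + e2 ^+ 2) * (u1 * v2 - u2 * v1) =
      (e1 * u1 + e2 * u2) * (e1 * v2 - e2 * v1) + (e1 * v1 + e2 * v2) * (e2 * u1 - e1 * u2).
      by ring.
    by rewrite eu ev !mul0r addr0.
  pose l := (u1 * v1 + u2 * v2) / (u1 ^+ 2 + u2 ^+ 2).
  have v1E : v1 = l * u1.
    have -> : v1 = ((u1 * v1 + u2 * v2) * u1 - (u1 * v2 - u2 * v1) * u2) / (u1 ^+ 2 + u2 ^+ 2).
      by field.
    by rewrite uv /l; field.
  have v2E : v2 = l * u2.
    have -> : v2 = ((u1 * v1 + u2 * v2) * u2 + (u1 * v2 - u2 * v1) * u1) / (u1 ^+ 2 + u2 ^+ 2).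
      by field.
    by rewrite uv /l; field.
  have : l * (l - 1) == 0.
    rewrite -(mulrI_eq0 _ (mulfI uN0)); apply/eqP.
    have -> : (u1 ^+ 2 + u2 ^+ 2) * (l * (l - 1)) =
      (v1 ^+ 2 + v2 ^+ 2 + 2 * (v1 * a1 + v2 * a2)) -
      l * (u1 ^+ 2 + u2 ^+ 2 + 2 * (u1 * a1 + u2 * a2)).
      by rewrite v1E v2E; ring.
    by rewrite au av mulr0 subrr.
  rewrite mulf_eq0 subr_eq0 => /orP[/eqP l0|/eqP l1].
    case: pw; move: v1E v2E; rewrite l0 !mul0r => /eqP; rewrite subr_eq0 => /eqP h1.
    move=> /eqP; rewrite subr_eq0 => /eqP h2.
    by rewrite [LHS]surjective_pairing [RHS]surjective_pairing h1 h2.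
  case: qw; move: v1E v2E; rewrite l1 !mul1r => /addIr h1 /addIr h2.
  by rewrite [LHS]surjective_pairing [RHS]surjective_pairing h1 h2.
move: eN0; rewrite paddr_eq0 ?sqr_ge0// !sqrf_eq0 !subr_eq0 => /andP[/eqP h1 /eqP h2].
by rewrite /circ -cp -cp' h1 h2.
Qed.

Lemma circI_finite c r c' r' : circ c r <> circ c' r' ->
  finite_set (circ c r `&` circ c' r').
Proof.
move=> neq; apply: contrapT; set I := _ `&` _ => infI; apply: neq.
have /set0P[p Ip] : I != set0 by apply/eqP => I0; apply: infI; rewrite I0.
have infp : infinite_set (I `\ p) by exact: infinite_setD1.
have /set0P[q [Iq qp]] : I `\ p != set0 by apply/eqP => I0; apply: infp; rewrite I0.
have infq : infinite_set (I `\ p `\ q) by exact: infinite_setD1.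
have /set0P[w [[Iw wp] wq]] : I `\ p `\ q != set0 by apply/eqP => I0; apply: infq; rewrite I0.
by apply: (circ_three _ _ _ Ip Iq Iw) => e; [apply: qp|apply: wp|apply: wq]; rewrite /= e.
Qed.

(** Otherwise [C], an infinite set, would be a finite union of finite intersections with other
    circles. *)
Lemma circle_in_family S C : finite_set S -> S `<=` @circle R -> circle C ->
  C `<=` \bigcup_(B in S) B -> S C.
Proof.
move=> finS circS [c [r [r0 CE]]] CS; rewrite -/(circ c r) in CE.
apply: contrapT => nSC; apply: (@circ_infinite c r r0); rewrite -CE.
have -> : C = \bigcup_(B in S) (C `&` B).
  by rewrite -setI_bigcupr; apply/esym/setIidPl.
apply: bigcup_finite => // B SB.
have [c' [r' [r'0 BE]]] := circS _ SB; rewrite -/(circ c' r') in BE.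
rewrite CE BE; apply: circI_finite => cc; apply: nSC.
by rewrite CE cc -BE.
Qed.

End CircleFamilies.


(** * Domains bounded by circles *)

Section CircleDomains.
Variable R : realType.
Implicit Types (c k p w x z : plane R) (r s : R) (S : set (set (plane R))).
Implicit Types (A C D K : set (plane R)).

(* [g C] is the power with respect to the circle [C], with the sign that makes it
   positive on [D]. *)
Definition side S D (g : set (plane R) -> plane R -> R) : Prop :=
  forall C, S C -> exists c r s, [/\ 0 < r, s = 1 \/ s = -1, C = circ c r,
    g C = (fun w => s * power c r w) & forall w, D w -> 0 < g C w].

(** The power with respect to each circle has no zero on the connected set [D], hence a constant
    sign there; outside [S] the chosen function is the default 0. *)
Lemma side_exists S D : S `<=` @circle R -> connected D ->
  (forall C, S C -> D `&` C `<=` set0) -> exists g, side S D g.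
Proof.
move=> circS cD DS.
have /choice[g gS] : forall C, exists h, S C -> exists c r s,
    [/\ 0 < r, s = 1 \/ s = -1, C = circ c r,
      h = (fun w => s * power c r w) & forall w, D w -> 0 < h w].
  move=> C; have [SC|nSC] := pselect (S C); last by exists (fun=> 0) => /nSC.
  have [c [r [r0 CE]]] := circS _ SC; rewrite -/(circ c r) in CE.
  have pN0 z : D z -> power c r z != 0.
    by move=> Dz; apply/eqP => /circE; rewrite -CE => Cz; exact: (DS C SC z).
  have [pos|neg] := connected_sign cD (@power_continuous _ c r) pN0.
    exists (fun w => 1 * power c r w) => _; exists c, r, 1; split => //; first by left.
    by move=> w /pos; rewrite mul1r.
  exists (fun w => -1 * power c r w) => _; exists c, r, (-1); split => //; first by right.
  by move=> w /neg; rewrite mulN1r oppr_gt0.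
by exists g.
Qed.

Lemma side_continuous S D g C : side S D g -> S C -> continuous (g C).
Proof.
move=> gS /gS[c [r [s [_ _ _ -> _]]]] z.
by apply: cvgM; [exact: cvg_cst | exact: power_continuous].
Qed.

Lemma side_zero S D g C : side S D g -> S C -> C = [set z | g C z = 0].
Proof.
move=> gS /gS[c [r [s [_ s1 CE gE _]]]]; rewrite gE {1}CE.
apply/seteqP; split => z; first by rewrite circE /= => ->; rewrite mulr0.
by rewrite circE /=; case: s1 => ->; rewrite ?mul1r// mulN1r => /eqP; rewrite oppr_eq0 => /eqP.
Qed.

Lemma side_closure S D g C z : side S D g -> S C -> closure D z -> 0 <= g C z.
Proof.
move=> gS SC; have gC := side_continuous gS SC.
have [c [r [s [_ _ _ _ gD]]]] := gS C SC.
have cl : closed [set w | 0 <= g C w].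
  have -> : [set w | 0 <= g C w] = g C @^-1` [set y : R | 0 <= y] by [].
  by apply: closed_comp => [? _|]; [exact: gC|exact: closed_ge].
have : D `<=` [set w | 0 <= g C w] by move=> w /gD /ltW.
move/closureS; move/closure_id: cl => <-; exact.
Qed.

Lemma near_avoid S z : finite_set S -> (forall C, S C -> closed C) ->
  (forall C, S C -> ~ C z) -> \forall w \near z, forall C, S C -> ~ C w.
Proof.
move=> finS clS Sz.
have op : open (~` \bigcup_(C in S) C) by apply: closed_openC; exact: closed_bigcup.
have : (~` \bigcup_(C in S) C) z by move=> [C SC Cz]; exact: (Sz C).
move: op; rewrite openE => /[apply] nz.
by apply: filterS nz => w Nw C SC Cw; apply: Nw; exists C.
Qed.

Lemma closed_circle C : circle C -> closed C.
Proof. by move=> [c [r [r0 ->]]]; exact: circ_closed. Qed.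

Lemma is_component_connected (T : topologicalType) (N E : set T) :
  is_component N E -> connected E.
Proof. by move=> [x _ ->]; exact: component_connected. Qed.

Lemma component_subset (T : topologicalType) (N E : set T) :
  is_component N E -> E `<=` N.
Proof. by move=> [x _ ->]; exact: connected_component_sub. Qed.

Lemma component_nonempty (T : topologicalType) (N E : set T) :
  is_component N E -> E !=set0.
Proof. by move=> [x Nx ->]; exists x; exact: connected_component_refl. Qed.

(** A small box around [z] misses all the circles, is connected, and meets [D]. *)
Lemma near_interior S D z : finite_set S -> S `<=` @circle R ->
  is_component (~` \bigcup_(C in S) C) D -> closure D z ->
  (forall C, S C -> ~ C z) -> \forall w \near z, D w.
Proof.
move=> finS circS DS clz Sz.
have /box_nbhs[e e0 eS] := near_avoid finS (fun C SC => closed_circle (circS C SC)) Sz.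
apply: filterS (nbhs_box z e0).
apply: (component_sub DS).
- apply: (@star_connected _ _ z) => p t bp tt; apply: box_seg => //.
  by rewrite /box /= !subrr; apply/andP; split; apply/andP; split; lra.
- by move=> w /eS Sw [C SC Cw]; exact: (Sw C).
- by have [w [Dw bw]] := clz _ (nbhs_box z e0); exists w.
Qed.

Lemma near_boundary S D g z C : finite_set S -> S `<=` @circle R ->
  is_component (~` \bigcup_(C in S) C) D -> side S D g -> closure D z ->
  S C -> C z -> (forall C', S C' -> C' z -> C' = C) ->
  \forall w \near z, 0 <= g C w -> closure D w.
Proof.
move=> finS circS DS gS clz SC Cz uniC.
have [c [r [s [r0 s1 CE gE gD]]]] := gS C SC.
rewrite gE; apply: (near_smooth_boundary s1 r0 DS clz).
- by apply/circE; rewrite -CE.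
- by move=> w /gD; rewrite gE.
have finS' : finite_set (S `\ C) by exact: finite_setD.
have cl C' : (S `\ C) C' -> closed C' by move=> [SC' _]; exact: closed_circle (circS _ SC').
have av C' : (S `\ C) C' -> ~ C' z by move=> [SC' CC] /(uniC _ SC').
apply: filterS (near_avoid finS' cl av) => w Sw sw [C' SC' C'w].
have [CC|CC] := pselect (C' = C); last exact: (Sw C').
by move: C'w; rewrite CC CE circE => pw; move: sw; rewrite pw mulr0 ltxx.
Qed.

(** [clopen_sides] applied to the disc: [near_interior] gives the local hypothesis off the circles,
    and [near_boundary] gives it on the only circle through a point of [B]. *)
Lemma connected_of_no_double S D k (rho : R) B :
  finite_set S -> S `<=` @circle R -> is_component (~` \bigcup_(C in S) C) D ->
  let X := disc k rho `&` closure D in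
  B !=set0 -> (exists2 U, open U & B = X `&` U) ->
  (exists2 F, closed F & B = X `&` F) ->
  (forall z C C', B z -> S C -> S C' -> C z -> C' z -> C' = C) ->
  B = X.
Proof.
move=> finS circS DS X B0 BU BF uniB.
have DavS C : S C -> D `&` C `<=` set0.
  by move=> SC w [Dw Cw]; apply: (component_subset DS Dw); exists C.
have [g gS] := side_exists circS (is_component_connected DS) DavS.
have BX : B `<=` X by case: BU => U _ -> z [].
apply: (@clopen_sides R _ (disc k rho) X B S g) => //.
- exact: disc_connected.
- by apply: closedI; [exact: disc_closed | exact: closed_closure].
- by move=> z [].
- by move=> C SC; exact: (side_continuous gS).
- by move=> C SC; exact: (side_zero gS).
- by move=> C /circS[c [r [_ ->]]]; exact: circI_disc_connected.
- by move=> C z SC [_]; exact: (side_closure gS).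
- move=> z Bz Sz; have [Kz clz] := BX _ Bz.
  apply: filterS (near_interior finS circS DS clz Sz) => w Dw Kw.
  by split => //; exact: subset_closure.
- move=> z C Bz SC Cz; have [Kz clz] := BX _ Bz.
  have uniC C' : S C' -> C' z -> C' = C by move=> SC' C'z; exact: (uniB z).
  apply: filterS (near_boundary finS circS DS gS clz SC Cz uniC) => w h Kw gw.
  by split => //; exact: h.
Qed.

Lemma two_double_points S D k (rho : R) : refined_domain S D -> S `<=` @circle R ->
  ~ connected (disc k rho `&` closure D) ->
  `I_2 #<= (disc k rho `&` boundary D) `&` double_points S.
Proof.
case=> finS _ _ DS _ le2 _ circS; set X := _ `&` closure D => ncX.
have clX : closed X by apply: closedI; [exact: disc_closed | exact: closed_closure].
have double B : B !=set0 -> (exists2 U, open U & B = X `&` U) ->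
    (exists2 F, closed F & B = X `&` F) -> B <> X ->
    exists2 z, B z & ((disc k rho `&` boundary D) `&` double_points S) z.
  move=> B0 BU BF BX; apply: contrapT => nd; apply: BX.
  apply: (connected_of_no_double finS circS DS B0 BU BF) => z C C' Bz SC SC' Cz C'z.
  apply: contrapT => CC; apply: nd; exists z => //.
  have [Kz clz] : X z by case: BU Bz => U _ -> [].
  split; first (split => //; split => // Dz).
    by apply: (component_subset DS Dz); exists C.
  (* A refined domain has at most two curves at a point of the closure, so two distinct ones make
     exactly two. *)
  rewrite /double_points /= card_eq_le le2//=.
  exact: (@two_le_card _ _ C' C).
move: ncX => /existsNP[B /not_implyP[B0 /not_implyP[BU /not_implyP[BF BX]]]].
have [p Bp dp] := double B B0 BU BF BX.
have [U oU BUE] := BU; have [F cF BFE] := BF.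
have BsX : B `<=` X by rewrite BUE => z [].
(* The complement of [B] in [X] is again relatively open and closed, with [U] and [F] exchanging
   their roles. *)
have DU : X `\` B = X `&` ~` F.
  by rewrite BFE setDIr setDv set0U setDE.
have DF : X `\` B = X `&` ~` U.
  by rewrite BUE setDIr setDv set0U setDE.
have [q [Xq nBq] dq] : exists2 z, (X `\` B) z &
    ((disc k rho `&` boundary D) `&` double_points S) z.
  apply: double.
  - apply/set0P/eqP => XB; apply: BX; apply/seteqP; split => // z Xz.
    by apply: contrapT => nBz; have : (X `\` B) z by []; rewrite XB.
  - by exists (~` F) => //; exact: closed_openC.
  - by exists (~` U) => //; exact: open_closedC.
  - move=> XB; have [z Bz] := B0; have := BsX _ Bz.
    by rewrite -XB => -[].
apply: (two_le_card dp dq) => pq.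
by apply: nBq; rewrite -pq.
Qed.

(** If the power were positive on [D], a ray from a point of [D] away from the centre would avoid
    the circle and stay in [D], against boundedness. So [D] is inside the open disc, which is
    connected and therefore equal to [D]. *)
Lemma bounded_component_disc c r D : 0 < r -> bounded_set D ->
  is_component (~` circ c r) D -> D = [set w | power c r w < 0].
Proof.
move=> r0 bD DC.
have pN0 z : D z -> power c r z != 0.
  by move=> Dz; apply/eqP => /circE; exact: (component_subset DC).
have [pos|neg] := connected_sign (is_component_connected DC) (@power_continuous _ c r) pN0.
  exfalso; have [z Dz] := component_nonempty DC.
  have pz := pos _ Dz.
  pose ray (t : R) : plane R := (c.1 + (1 + t) * (z.1 - c.1), c.2 + (1 + t) * (z.2 - c.2)).
  pose d := (z.1 - c.1) ^+ 2 + (z.2 - c.2) ^+ 2.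
  have dr : r < d by move: pz; rewrite /power /d; lra.
  have prayE t : power c r (ray t) = (1 + t) ^+ 2 * d - r by rewrite /power /ray /d /=; ring.
  have pray t : 0 <= t -> 0 < power c r (ray t).
    by move=> t0; rewrite prayE; nra.
  have rayD t : 0 <= t -> D (ray t).
    move=> t0.
    have sub : ray @` `[0, t] `<=` D.
      apply: (component_sub DC).
      - apply: connected_continuous_connected; first exact: segment_connected.
        apply: continuous_subspaceT.
        have lin (x y : R) : continuous (fun t : R => x + (1 + t) * y).
          move=> u; apply: cvgD; first exact: cvg_cst.
          apply: cvgM; last exact: cvg_cst.
          by apply: cvgD; [exact: cvg_cst | exact: cvg_id].
        exact: pair_continuous.
      - move=> _ [u + <-]; rewrite /= in_itv /= => /andP[u0 _] /circE pE.
        by have := pray u u0; rewrite pE ltxx.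
      - exists z; split => //; exists 0; first by rewrite /= in_itv /= lexx.
        by rewrite /ray [RHS]surjective_pairing; congr pair; ring.
    by apply: sub; exists t => //; rewrite /= in_itv /= lexx t0.
  have [M M0 HM] := pinfty_ex_gt0 bD.
  have cM w : D w -> `|w.1| <= M /\ `|w.2| <= M.
    move=> /HM; rewrite /= /Num.norm /= => h; split.
      by apply: le_trans h; rewrite le_max lexx.
    by apply: le_trans h; rewrite le_max lexx orbT.
  (* [Q] bounds the squared distance to [c] on [D], while the point of the ray at parameter [Q / d]
     is at squared distance at least [d + 2 * Q]. *)
  pose Q := (M + `|c.1|) ^+ 2 + (M + `|c.2|) ^+ 2.
  have Q0 : 0 <= Q by rewrite addr_ge0 ?sqr_ge0.
  have d0 : 0 < d by lra.
  have t0 : 0 <= Q / d by rewrite divr_ge0// ltW.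
  have [r1 r2] := cM _ (rayD _ t0).
  have sq (a b : R) : `|a + b| <= M -> b ^+ 2 <= (M + `|a|) ^+ 2.
    move=> ab; rewrite -(real_normK (num_real b)) ler_sqr ?nnegrE ?addr_ge0 ?(ltW M0)//.
    have -> : b = (a + b) - a by ring.
    by apply: le_trans (ler_normB _ _) _; rewrite lerD2r.
  have h1 := sq _ _ r1; have h2 := sq _ _ r2.
  have : (1 + Q / d) ^+ 2 * d <= Q.
    by apply: le_trans (lerD h1 h2); rewrite /d !exprMn -mulrDr lexx.
  have -> : (1 + Q / d) ^+ 2 * d = d + 2 * Q + Q ^+ 2 / d.
    by field; rewrite gt_eqF.
  have : 0 <= Q ^+ 2 / d by rewrite divr_ge0 ?sqr_ge0// ltW.
  lra.
apply/seteqP; split => [w /neg //|].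
apply: (component_sub DC).
- apply: (@star_connected _ _ c) => p t /= pp /andP[t0 t1].
  have [->|tN] := eqVneq t 0; first by rewrite seg0.
  apply: open_disc_seg; [by rewrite t1 lt_def tN t0|exact: ltW|].
  by rewrite /power !subrr expr0n /= addr0 sub0r oppr_lt0.
- by move=> w /= pw /circE pE; move: pw; rewrite pE ltxx.
- by have [z Dz] := component_nonempty DC; exists z; split => //; exact: neg.
Qed.

End CircleDomains.

(** * Boundary circles and double points in the closed disc *)

Section MainHalf.
Variable R : realType.
Implicit Types (c k p w x z : plane R) (r s : R) (S : set (set (plane R))).
Implicit Types (A C D : set (plane R)).

Lemma closure_open_disc c r : 0 < r -> closure [set w | power c r w < 0] = disc c r.
Proof.
move=> r0; apply/seteqP; split.
  have : [set w | power c r w < 0] `<=` disc c r by move=> w /ltW.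
  by move/closureS; move/closure_id: (@disc_closed _ c r) => <-.
move=> w dw; apply: (@seg_closure _ _ _ c) => t tt; apply: open_disc_seg => //.
by rewrite /power !subrr expr0n /= addr0 sub0r oppr_lt0.
Qed.

Lemma admissible_disc S D A Sj Dj : circle Sj -> admissible S D A Sj Dj ->
  exists k (rho : R), closure Dj = disc k rho.
Proof.
move=> [k [rho [rho0 SjE]]] [_ _ _ [Aj [_ _ [[_ _ bD DC _ _ _] _ _ _] _]]].
rewrite bigcup_set1 SjE -/(circ k rho) in DC.
exists k, rho; rewrite -closure_open_disc//; congr closure.
exact: (bounded_component_disc rho0 bD DC).
Qed.

(** The horizontal chord through an interior point has both ends on the circle, and discs are
    convex. *)
Lemma disc_contains_interior c r k (rho : R) : circ c r `<=` disc k rho ->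
  [set w | power c r w < 0] `<=` disc k rho.
Proof.
move=> cK w /= pw.
have q0 : 0 <= r - (w.2 - c.2) ^+ 2.
  by move: pw; rewrite /power; have := sqr_ge0 (w.1 - c.1); lra.
pose h := Num.sqrt (r - (w.2 - c.2) ^+ 2).
have h2 : h ^+ 2 = r - (w.2 - c.2) ^+ 2 by rewrite sqr_sqrtr.
have h0 : 0 <= h := sqrtr_ge0 _.
have wh : (w.1 - c.1) ^+ 2 < h ^+ 2 by rewrite h2; move: pw; rewrite /power; lra.
have := wh; rewrite -[X in X < _ -> _]real_normK ?num_real// ltr_sqr ?nnegrE//.
rewrite ltr_norml => /andP[wl wr].
have hgt : 0 < h by lra.
have on1 : circ c r (c.1 - h, w.2) by rewrite /circ /= addrAC subrr add0r sqrrN h2; ring.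
have on2 : circ c r (c.1 + h, w.2) by rewrite /circ /= addrAC subrr add0r h2; ring.
have -> : w = seg (c.1 - h, w.2) (c.1 + h, w.2) ((w.1 - c.1 + h) / (2 * h)).
  have hN0 : h != 0 by rewrite gt_eqF.
  by rewrite [LHS]surjective_pairing /seg /=; congr pair; field.
apply: disc_seg; [|exact: cK|exact: cK].
by rewrite divr_ge0 ?ler_pdivrMr /=; lra.
Qed.

Definition extreme_points c r : set (plane R) :=
  [set (c.1 + Num.sqrt r, c.2); (c.1 - Num.sqrt r, c.2);
       (c.1, c.2 + Num.sqrt r); (c.1, c.2 - Num.sqrt r)].

Lemma extreme_points_circ c r : 0 < r -> extreme_points c r `<=` circ c r.
Proof.
move=> r0 _ [[[->|->]|->]|->]; rewrite /circ /= subrr expr0n /=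
  ?addr0 ?add0r addrAC subrr add0r ?sqrrN sqr_sqrtr ?ltW//.
Qed.

(** Sharing the other coordinate with the centre makes the radius at [p] parallel to axis [i], hence
    the tangent orthogonal to it. *)
Lemma projection_singular_circ S D (i : 'I_2) c r p :
  0 < r -> S (circ c r) -> circ c r p -> (boundary D `\` double_points S) p ->
  coord (if i == ord0 then ord_max else ord0) p =
    coord (if i == ord0 then ord_max else ord0) c ->
  projection_singular S D i p.
Proof.
move=> r0 SC Cp bp pc; have pN0 := circ_neq_center r0 Cp.
split => //; exists (circ c r); split => //; first exact: circ_not_line.
move=> v /tangent_circ; move: pc; rewrite /coord; case: (i == ord0) => /= pc /(_ r0 Cp).
  rewrite pc subrr mul0r addr0 => /eqP; rewrite mulf_eq0 => /orP[/eqP h|/eqP//].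
  by move: pN0; rewrite pc h subrr expr0n /= addr0 ltxx.
rewrite pc subrr mul0r add0r => /eqP; rewrite mulf_eq0 => /orP[/eqP h|/eqP//].
by move: pN0; rewrite pc h subrr expr0n /= addr0 ltxx.
Qed.

Lemma extreme_points_pole S D c r p : S (circ c r) -> 0 < r ->
  circ c r `<=` boundary D -> extreme_points c r p -> exists i, F_set S D i p.
Proof.
move=> SC r0 CD ep.
have Cp := extreme_points_circ r0 ep.
have [clp Dp] := CD _ Cp.
have [dp|ndp] := pselect (double_points S p); first by exists ord0; left.
have [h1|h2] : p.2 = c.2 \/ p.1 = c.1.
  by case: ep => [[[->|->]|->]|->]; [left|left|right|right].
- by exists ord0; right; exact: (projection_singular_circ r0 SC Cp).
- by exists ord_max; right; exact: (projection_singular_circ r0 SC Cp).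
Qed.

Lemma no_boundary_circle S D A Sj Dj x C : disconnected_LS_circles S D A Sj Dj x ->
  circle C -> ~ (C `<=` closure Dj `&` boundary D).
Proof.
case=> -[refD finA AbD FA] AE [Djx [clx nDx]] adm circS circS' LSx _ circC CK.
(* A point of the closure of [D] off every circle of [S] is interior to [D], so [C] is covered by
   the circles of [S]. *)
have SC : S C.
  apply: (circle_in_family _ circS circC); first by case: refD.
  move=> p /CK[_ [clp nDp]]; apply: contrapT => nS; apply: nDp.
  case: refD => finS _ _ DS _ _ _.
  apply: nbhs_singleton; apply: (near_interior finS circS DS clp) => B SB Bp.
  by apply: nS; exists B.
have [c [r [r0 CE]]] := circC; rewrite -/(circ c r) in CE; rewrite CE in SC CK.
have cross p : extreme_points c r p -> p.1 = x.1 \/ p.2 = x.2.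
  move=> ep; have [Kp bp] := CK _ (extreme_points_circ r0 ep).
  have [px|px] := pselect (p = x); first by left; rewrite px.
  have bD : circ c r `<=` boundary D by move=> w /CK[].
  have [i Fp] := extreme_points_pole SC r0 bD ep.
  have Ap : ((A `&` closure Dj `&` closure D) `\ x) p.
    by split => //; split; [split => //; apply: FA; exists i|case: bp].
  by case: LSx => [E0|[_]]; [move: Ap; rewrite E0|exact].
have sr0 : 0 < Num.sqrt r by rewrite sqrtr_gt0.
(* The two horizontal extremes have distinct abscissas, so one of them lies on the horizontal line
   through [x]; similarly for the vertical ones. *)
have [/= e1 e2] : x.1 = c.1 /\ x.2 = c.2.
  have /= := cross _ (or_introl (or_introl (or_introl erefl))).
  have /= := cross _ (or_introl (or_introl (or_intror erefl))).
  have /= := cross _ (or_introl (or_intror erefl)).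
  have /= := cross _ (or_intror erefl).
  by do 4! case=> ?; split; lra.
have xc : x = c by rewrite [LHS]surjective_pairing [RHS]surjective_pairing e1 e2.
have [finS _ _ DS _ _ _] := refD.
have DavS B : S B -> D `&` B `<=` set0.
  by move=> SB w [Dw Bw]; apply: (component_subset DS Dw); exists B.
have pN0 z : D z -> power c r z != 0.
  by move=> Dz; apply/eqP => /circE Cz; exact: (DavS _ SC z).
have pc : power c r c < 0 by rewrite /power !subrr expr0n /= addr0 sub0r oppr_lt0.
have Din : D `<=` [set w | power c r w < 0].
  have [pos|//] := connected_sign (is_component_connected DS) (@power_continuous _ c r) pN0.
  rewrite xc in clx; have [w [Dw /= pw]] := clx _ (nbhs_power_lt pc).
  by have := pos _ Dw; lra.
have [k [rho KE]] : exists k (rho : R), closure Dj = disc k rho.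
  by apply: admissible_disc adm; apply: circS'; right.
have DK : D `<=` closure Dj.
  rewrite KE; apply: (subset_trans Din); apply: disc_contains_interior.
  by rewrite -KE => w /CK[].
(* The new domain is a component, hence nonempty, but all of [D] has been removed. *)
case: adm => _ _ _ [Aj [_ _ _ [[_ _ _ D'S _ _ _] _ _ _]]].
have [w [Dw]] := component_nonempty D'S.
by apply; exact: DK.
Qed.

Lemma contains_two_double_points S D A Sj Dj x : disconnected_LS_circles S D A Sj Dj x ->
  contains_double_points S D Dj 2.
Proof.
case=> -[refD _ _ _] _ _ adm circS circS' _ ncon.
have [k [rho KE]] : exists k (rho : R), closure Dj = disc k rho.
  by apply: admissible_disc adm; apply: circS'; right.
rewrite /contains_double_points KE; apply: two_double_points => //.
by rewrite -KE.
Qed.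

End MainHalf.

(** * Finiteness of poles and a criterion for admissibility *)

Section Poles.
Variable R : realType.
Implicit Types (c k p w x z : plane R) (r s : R) (S : set (set (plane R))).
Implicit Types (A C D : set (plane R)).

Lemma two_le_cardP (T : Type) (A : set T) :
  `I_2 #<= A -> exists a b, [/\ A a, A b & a <> b].
Proof.
move=> A2; apply: contrapT => nA.
have [[a Aa]|A0] := pselect (exists a, A a); last first.
  have AE : A = set0 by apply/seteqP; split => // a Aa; apply: A0; exists a.
  by move: A2; rewrite AE card_le0 => /eqP/seteqP[/(_ 0%N)] /(_ isT).
have A1 : A `<=` (fun=> a) @` `I_1.
  move=> b Ab; exists 0%N => //; apply: contrapT => ab; apply: nA.
  by exists a, b.
have := card_le_trans A2 (card_le_trans (subset_card_le A1) (card_image_le _ _)).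
by rewrite card_le_II.
Qed.

Lemma card_le_two (T : Type) (A : set T) a b : A `<=` [set a; b] -> A #<= `I_2.
Proof.
move=> Aab; apply: card_le_trans (card_image_le (fun n => if n == 0%N then a else b) _).
apply: subset_card_le => x /Aab[->|->]; first by exists 0%N.
by exists 1%N.
Qed.

Lemma double_pointsP S p : double_points S p ->
  exists C C', [/\ S C, S C', C p, C' p & C <> C'].
Proof.
rewrite /double_points /= card_eq_le => /andP[_ /two_le_cardP[C [C' [[SC Cp] [SC' C'p] CC]]]].
by exists C, C'.
Qed.

Lemma projection_singular_extreme S D i p : projection_singular S D i p ->
  exists C, [/\ S C, C p & forall c r, 0 < r -> C = circ c r -> p.1 = c.1 \/ p.2 = c.2].
Proof.
move=> [_ [C [SC Cp _ tC]]]; exists C; split => // c r r0 CE; rewrite CE in Cp tC.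
have /tC : tangent_space (circ c r) p (- (p.2 - c.2), p.1 - c.1).
  by apply/tangent_circ => //=; ring.
by rewrite /coord; case: (i == ord0) => /=; [right|left]; lra.
Qed.

(** Double points lie in intersections of pairs of distinct circles, and singular points among the
    four extreme points of each circle. *)
Lemma F_set_finite S D i : finite_set S -> S `<=` @circle R -> finite_set (F_set S D i).
Proof.
move=> finS circS; rewrite finite_setU; split.
  pose P := [set CC : set (plane R) * set (plane R) | (S `*` S) CC /\ CC.1 <> CC.2].
  apply: (@sub_finite_set _ _ (\bigcup_(CC in P) (CC.1 `&` CC.2))).
    move=> p [_ /double_pointsP[C [C' [SC SC' Cp C'p CC]]]].
    by exists (C, C').
  apply: bigcup_finite.
    by apply: sub_finite_set (finite_setX finS finS) => CC [].
  move=> [C C'] [[/= SC SC'] CC].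
  have [c [r [_ CE]]] := circS _ SC; have [c' [r' [_ CE']]] := circS _ SC'.
  rewrite -/(circ c r) in CE; rewrite -/(circ c' r') in CE'; rewrite CE CE' in CC *.
  exact: circI_finite.
pose ext C := [set p | C p /\ forall c r, 0 < r -> C = circ c r -> p.1 = c.1 \/ p.2 = c.2].
apply: (@sub_finite_set _ _ (\bigcup_(C in S) ext C)).
  by move=> p /projection_singular_extreme[C [SC Cp pc]]; exists C.
apply: bigcup_finite => // C SC.
have [c [r [r0 CE]]] := circS _ SC; rewrite -/(circ c r) in CE.
apply: (@sub_finite_set _ _ (extreme_points c r)); last exact: finite_set4.
move=> p [Cp /(_ c r r0 CE) pc]; move: Cp; rewrite CE /circ /=.
have sqE (u : R) : u ^+ 2 = r -> u = Num.sqrt r \/ u = - Num.sqrt r.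
  move=> <-; rewrite sqrtr_sqr; have [u0|u0] := leP 0 u; first by left; rewrite ger0_norm.
  by right; rewrite ltr0_norm// opprK.
case: pc => pE; rewrite pE subrr expr0n /= ?add0r ?addr0 => /sqE[] h.
- by left; right; rewrite /= [LHS]surjective_pairing pE -h; congr pair; ring.
- by right; rewrite /= [LHS]surjective_pairing pE -h; congr pair; ring.
- by left; left; left; rewrite /= [LHS]surjective_pairing pE -h; congr pair; ring.
- by left; left; right; rewrite /= [LHS]surjective_pairing pE -h; congr pair; ring.
Qed.

Definition poles S D : set (plane R) := \bigcup_i F_set S D i.

Lemma poles_finite S D : finite_set S -> S `<=` @circle R -> finite_set (poles S D).
Proof. by move=> finS circS; apply: bigcup_finite => // i _; exact: F_set_finite. Qed.

Lemma poles_curve S D p : poles S D p -> closure D p /\ exists2 C, S C & C p.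
Proof.
move=> [i _ [[clp /double_pointsP[C [_ [SC _ Cp _ _]]]]|[[[clp _] _] [C [SC Cp _ _]]]]].
  by split => //; exists C.
by split => //; exists C.
Qed.

Lemma poles_boundary S D : is_component (~` \bigcup_(C in S) C) D ->
  poles S D `<=` boundary D.
Proof.
move=> DS p /poles_curve[clp [C SC Cp]]; split => // Dp.
by apply: (component_subset DS Dp); exists C.
Qed.

Lemma refined_domain_poles S D : S `<=` @circle R -> refined_domain S D ->
  refined_domain_with_poles S D (poles S D).
Proof.
move=> circS refD; split => //.
- by apply: poles_finite => //; case: refD.
- by apply: poles_boundary; case: refD.
Qed.

Lemma admissible_poles S D Sj Dj : S `<=` @circle R -> circle Sj -> ~ S Sj ->
  refined_domain S D -> refined_domain [set Sj] Dj ->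
  refined_domain (S `|` [set Sj]) (D `&` ~` closure Dj) ->
  admissible S D (poles S D) Sj Dj.
Proof.
move=> circS circj nSj refD refj refD'; set D' := D `&` _ in refD' *.
have circ1 : [set Sj] `<=` @circle R by move=> _ ->.
have circS' : S `|` [set Sj] `<=` @circle R by move=> C [/circS|->].
have fin1 : finite_set [set Sj] by exact: finite_set1.
have finS : finite_set S by case: refD.
have finS' : finite_set (S `|` [set Sj]) by rewrite finite_setU.
have DS : is_component (~` \bigcup_(C in S) C) D by case: refD.
have DS' : is_component (~` \bigcup_(C in S `|` [set Sj]) C) D' by case: refD'.
have DSj : is_component (~` \bigcup_(C in [set Sj]) C) Dj by case: refj.
split => //.
- by have [c [r [r0 ->]]] := circj; have [f [cf _]] := circ_curve c r0; exists f.
- by rewrite bigcup_set1 in DSj.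
(* Besides the poles of the disc, [Aj] takes those of the new domain lying on [Sj]; off [Sj] the
   same curves pass through a point in both families, so the remaining poles are old ones. *)
pose Aj := Sj `&` (poles [set Sj] Dj `|` poles (S `|` [set Sj]) D').
have finAj : finite_set Aj by apply: finite_setIr; rewrite finite_setU; split; exact: poles_finite.
have AjS : Aj `<=` Sj by move=> p [].
exists Aj; split => //.
  split => //.
  - move=> p [Sjp _]; split; last first.
      by move=> Djp; apply: (component_subset DSj Djp); exists Sj.
    have [c [r [r0 SjE]]] := circj; rewrite -/(circ c r) in SjE.
    have bDj : bounded_set Dj by case: refj.
    rewrite bigcup_set1 SjE in DSj.
    rewrite (bounded_component_disc r0 bDj DSj) closure_open_disc//.
    by rewrite SjE circE in Sjp; rewrite /disc /= Sjp.
  - move=> p pp; split; last by left.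
    by have [_ [C -> Cp]] := poles_curve pp.
split => //.
- by apply: finite_setIl; rewrite finite_setU; split => //; exact: poles_finite.
- move=> p [Ap clp]; split => // D'p.
  case: Ap => [Ap|[Sjp _]]; last by apply: (component_subset DS' D'p); exists Sj => //; right.
  by have [_] := poles_boundary DS Ap; apply; case: D'p.
move=> p pp; have [clp [C0 SC0 C0p]] := poles_curve pp; split => //.
have [Sjp|nSjp] := pselect (Sj p); first by right; split => //; right.
left; have clDp : closure D p by apply: closureS clp => w [].
have curvesE : curves_at (S `|` [set Sj]) p = curves_at S p.
  apply/seteqP; split => C [SC Cp]; split => //; last by left.
  by case: SC => // CE; case: nSjp; rewrite -CE.
case: pp => i _ [[_ dp]|[[_ ndp] [C [SC Cp nl tC]]]]; exists i => //.
  by left; split => //; rewrite /double_points /= -curvesE.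
have SC' : S C by case: SC => // CE; case: nSjp; rewrite -CE.
right; split; last by exists C.
split; last by rewrite /double_points /= -curvesE.
by split => // Dp; apply: (component_subset DS Dp); exists C.
Qed.

End Poles.

(** * Star-shaped regions and the crescent *)

Section StarDomains.
Variable R : realType.
Implicit Types (c k p q w z : plane R) (r s t : R) (L : seq (plane R * R * R)).
Implicit Types (a b : plane R * R * R).

(* A triple [(c, r, s)] stands for the circle of centre [c] and squared radius [r],
   with the side on which the power has the sign of [s]. *)
Definition trace a : set (plane R) := circ a.1.1 a.1.2.

Definition spower a w : R := a.2 * power a.1.1 a.1.2 w.

Definition signed_circle a : Prop := 0 < a.1.2 /\ (a.2 = 1 \/ a.2 = -1).

Definition family L : set (set (plane R)) := trace @` [set` L].

Definition region L : set (plane R) := [set w | forall a, a \in L -> 0 < spower a w].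

Definition closed_region L : set (plane R) :=
  [set w | forall a, a \in L -> 0 <= spower a w].

(** The segments start in the closed region and enter the open one at once, which makes
    [closed_region] the closure of [region]. *)
Definition star_region L q : Prop := region L q /\
  forall p t, closed_region L p -> 0 < t <= 1 -> region L (seg p q t).

Lemma spower_continuous a : continuous (spower a).
Proof. by move=> z; apply: cvgM; [exact: cvg_cst | exact: power_continuous]. Qed.

Lemma traceE a w : signed_circle a -> trace a w <-> spower a w = 0.
Proof.
move=> [_ s1]; rewrite /trace circE /spower; case: s1 => ->; first by rewrite mul1r.
by rewrite mulN1r; split => [->|/eqP]; rewrite ?oppr0// oppr_eq0 => /eqP.
Qed.

Lemma familyP L (C : set (plane R)) :
  family L C <-> exists2 a, a \in L & C = trace a.
Proof. by split=> -[a aL CE]; exists a. Qed.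

Lemma region_closure L q : star_region L q -> closure (region L) = closed_region L.
Proof.
move=> [_ Lq]; apply/seteqP; split; last first.
  by move=> p cp; apply: (@seg_closure _ _ _ q) => t tt; exact: Lq.
move=> p clp a aL; have cl : closed [set w | 0 <= spower a w].
  have -> : [set w | 0 <= spower a w] = spower a @^-1` [set y : R | 0 <= y] by [].
  by apply: closed_comp => [? _|]; [exact: spower_continuous|exact: closed_ge].
have : region L `<=` [set w | 0 <= spower a w] by move=> w /(_ a aL)/ltW.
by move/closureS; move/closure_id: cl => <-; exact.
Qed.

(** On a connected set containing [q] and avoiding the circles, each signed power keeps the sign it
    has at [q]; so the component of [q] is no larger than the region. *)
Lemma region_component L q : (forall a, a \in L -> signed_circle a) -> star_region L q ->
  is_component (~` \bigcup_(C in family L) C) (region L).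
Proof.
move=> Ls [Lq0 Lq].
have av : region L `<=` ~` \bigcup_(C in family L) C.
  move=> w Lw [_ [a /= aL <-]] /(traceE _ (Ls a aL)) a0.
  by have := Lw a aL; rewrite a0 ltxx.
exists q; first exact: av.
apply/seteqP; split.
  apply: connected_component_max => //.
  apply: (@star_connected _ _ q) => p t Lp /andP[t0 t1].
  have [->|tN] := eqVneq t 0; first by rewrite seg0.
  by apply: Lq; [move=> a /Lp/ltW | rewrite t1 lt_def tN t0].
move=> w [Z [Zq Zav cZ] Zw] a aL.
have aN0 z : Z z -> spower a z != 0.
  move=> Zz; apply/eqP => /(traceE _ (Ls a aL)) az; apply: (Zav _ Zz).
  by exists (trace a) => //; exists a.
have [pos|neg] := connected_sign cZ (@spower_continuous a) aN0; first exact: pos.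
by have := neg _ Zq; have := Lq0 a aL; lra.
Qed.

Lemma bounded_in_disc c r (A : set (plane R)) :
  A `<=` [set w | power c r w < 0] -> bounded_set A.
Proof.
move=> Ac; pose M : R := `|c.1| + `|c.2| + 1 + `|r|.
have sq (x y : R) : (x - y) ^+ 2 < r -> `|x| <= `|y| + 1 + `|r|.
  move=> xy; have -> : x = y + (x - y) by ring.
  apply: le_trans (ler_normD _ _) _; rewrite -addrA lerD2l.
  have := ler_norm r; have := normr_ge0 (x - y); move: xy.
  by rewrite -(real_normK (num_real (x - y))); nra.
exists M; split; first exact: num_real.
move=> N MN w /Ac /= pw; apply: le_trans (ltW MN); rewrite /Num.norm /= ge_max.
move: pw; rewrite /power => pw.
have := sqr_ge0 (w.1 - c.1); have := sqr_ge0 (w.2 - c.2) => h2 h1.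
have := sq w.1 c.1; have := sq w.2 c.2; have := normr_ge0 c.1; have := normr_ge0 c.2.
rewrite /M => n2 n1 s2 s1; apply/andP; split.
  by apply: le_trans (s1 _) _; lra.
by apply: le_trans (s2 _) _; lra.
Qed.

Lemma refined_region L q : (forall a, a \in L -> signed_circle a) -> star_region L q ->
  bounded_set (region L) ->
  (forall a, a \in L -> exists2 p, closed_region L p & trace a p) ->
  (forall p, closed_region L p -> curves_at (family L) p #<= `I_2) ->
  (forall p a b, closed_region L p -> a \in L -> b \in L -> a != b ->
     trace a p -> trace b p ->
     (p.1 - a.1.1.1) * (p.2 - b.1.1.2) - (p.2 - a.1.1.2) * (p.1 - b.1.1.1) != 0) ->
  refined_domain (family L) (region L).
Proof.
move=> Ls Lq bL meetL le2 trL; have clE := region_closure Lq.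
split => //.
- by apply: finite_image; exact: finite_seq.
- by move=> _ [a /= aL <-]; apply: circ_curve; have [] := Ls a aL.
- exact: region_component Lq.
- by move=> _ [a /= aL <-]; have [p cp ap] := meetL a aL; exists p; rewrite clE.
- by move=> p; rewrite clE; exact: le2.
- move=> p _ _ + [a /= aL <-] [b /= bL' <-] ab ap bp; rewrite clE => cp.
  have [a0 _] := Ls a aL; have [b0 _] := Ls b bL'.
  apply: transversal_circ => //; apply: trL => //.
  by apply/eqP => abE; apply: ab; rewrite abE.
Qed.

Lemma family_circle L : (forall a, a \in L -> signed_circle a) -> family L `<=` @circle R.
Proof.
by move=> Ls _ [a /= aL <-]; have [a0 _] := Ls a aL; exists a.1.1, a.1.2.
Qed.

End StarDomains.

(** * Optimality: a crescent whose two tips are cut off *)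

Section Example.
Variable R : realType.
Implicit Types (p q w : plane R).

Let unit_in : plane R * R * R := ((0, 0), 1, -1).
Let hole_out : plane R * R * R := ((2, 0), 5, 1).
(** The squared radius lies between 17, the squared distance from [(4, 0)] to the tips, and about
    17.94, that to the nearest point of the closed crescent on the first axis. The circle passes
    through the rational point [(- 1 / 10, 4 / 5)]. *)
Let cut_in : plane R * R * R := ((4, 0), 349 / 20, -1).
Let cut_out : plane R * R * R := ((4, 0), 349 / 20, 1).

Let crescent := [:: unit_in; hole_out].
Let cut_crescent := [:: unit_in; hole_out; cut_out].
(** The polar lines of this point for the circles centred at [(2, 0)] and [(4, 0)] are vertical with
    positive abscissa, so the crescent is beyond them as [exterior_seg] requires. *)
Let base : plane R := (- (3 / 4), 0).

Lemma closed_crescentE w : closed_region crescent w <->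
  w.1 ^+ 2 + w.2 ^+ 2 <= 1 /\ 0 <= w.1 ^+ 2 + w.2 ^+ 2 - 4 * w.1 - 1.
Proof.
split=> [cw|[h1 h2] a].
  have := cw unit_in; have := cw hole_out; rewrite !inE !eqxx orbT /spower /power /=.
  by move=> /(_ isT) h1 /(_ isT) h2; split; lra.
by rewrite !inE => /orP[]/eqP ->; rewrite /spower /power /=; lra.
Qed.

Lemma crescent_le0 w : closed_region crescent w -> w.1 <= 0.
Proof. by move=> /closed_crescentE[]; lra. Qed.

Lemma closed_cut_crescentE w : closed_region cut_crescent w <->
  closed_region crescent w /\ 0 <= w.1 ^+ 2 + w.2 ^+ 2 - 8 * w.1 - 29 / 20.
Proof.
split=> [cw|[h1 h2] a].
  split; first by move=> a; rewrite !inE => /orP[]/eqP ->; apply: cw; rewrite !inE eqxx ?orbT.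
  have := cw cut_out; rewrite !inE !eqxx !orbT /spower /power /= => /(_ isT); lra.
rewrite !inE => /or3P[]/eqP -> ; try by apply: h1; rewrite !inE eqxx ?orbT.
by rewrite /spower /power /=; lra.
Qed.

Lemma crescent_signed a : a \in crescent -> signed_circle a.
Proof.
by rewrite !inE => /orP[]/eqP ->; (split => /=; [lra|]); [right|left].
Qed.

Lemma cut_crescent_signed a : a \in cut_crescent -> signed_circle a.
Proof.
rewrite !inE => /or3P[]/eqP ->; (split => /=; [lra|]); by [right|left].
Qed.

Lemma spower_unit_seg p t : closed_region crescent p -> 0 < t <= 1 ->
  0 < spower unit_in (seg p base t).
Proof.
move=> /closed_crescentE[h1 h2] tt; rewrite /spower mulN1r oppr_gt0.
by apply: open_disc_seg => //; rewrite /power /=; lra.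
Qed.

Lemma spower_hole_seg p t : closed_region crescent p -> 0 < t <= 1 ->
  0 < spower hole_out (seg p base t).
Proof.
move=> cp tt; have := crescent_le0 cp; move/closed_crescentE: cp => [h1 h2] p0.
by rewrite /spower mul1r; apply: exterior_seg => //; rewrite /power /=; lra.
Qed.

Lemma crescent_star : star_region crescent base.
Proof.
split; last first.
  move=> p t cp tt a; rewrite !inE => /orP[]/eqP ->.
    exact: spower_unit_seg.
  exact: spower_hole_seg.
by move=> a; rewrite !inE => /orP[]/eqP ->; rewrite /spower /power /=; lra.
Qed.

Lemma cut_crescent_star : star_region cut_crescent base.
Proof.
split; last first.
  move=> p t /closed_cut_crescentE[cp h] tt a; rewrite !inE => /or3P[]/eqP ->.
  - exact: spower_unit_seg.
  - exact: spower_hole_seg.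
  have p0 := crescent_le0 cp.
  by rewrite /spower mul1r; apply: exterior_seg => //; rewrite /power /=; lra.
by move=> a; rewrite !inE => /or3P[]/eqP ->; rewrite /spower /power /=; lra.
Qed.

Lemma cut_star : star_region [:: cut_in] (4, 0).
Proof.
split; last first.
  move=> p t cp tt a; rewrite inE => /eqP ->.
  have := cp cut_in; rewrite inE eqxx => /(_ isT).
  rewrite /spower !mulN1r oppr_ge0 oppr_gt0 => pp.
  by apply: open_disc_seg => //; rewrite /power /=; lra.
by move=> a; rewrite inE => /eqP ->; rewrite /spower /power /=; lra.
Qed.

Lemma trace_unitE p : trace unit_in p <-> p.1 ^+ 2 + p.2 ^+ 2 = 1.
Proof. by rewrite /trace circE /power /=; split => ?; lra. Qed.

Lemma trace_holeE p : trace hole_out p <-> p.1 ^+ 2 + p.2 ^+ 2 = 4 * p.1 + 1.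
Proof. by rewrite /trace circE /power /=; split => ?; lra. Qed.

Lemma trace_cutE p : trace cut_out p <-> p.1 ^+ 2 + p.2 ^+ 2 = 8 * p.1 + 29 / 20.
Proof. by rewrite /trace circE /power /=; split => ?; lra. Qed.

(** All the centres are on the first axis, so tangency could only occur on that axis. *)
Lemma trace_det p : p.2 != 0 -> forall a b : plane R * R * R,
  a.1.1.2 = 0 -> b.1.1.2 = 0 -> a.1.1.1 != b.1.1.1 ->
  (p.1 - a.1.1.1) * (p.2 - b.1.1.2) - (p.2 - a.1.1.2) * (p.1 - b.1.1.1) != 0.
Proof.
move=> p0 a b -> -> ab; rewrite !subr0.
have -> : (p.1 - a.1.1.1) * p.2 - p.2 * (p.1 - b.1.1.1) = p.2 * (b.1.1.1 - a.1.1.1) by ring.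
by rewrite mulf_neq0// subr_eq0 eq_sym.
Qed.

Lemma crescent_bounded L : {subset crescent <= L} -> bounded_set (region L).
Proof.
move=> sL; have uL : unit_in \in L by apply: sL; rewrite inE eqxx.
by apply: (@bounded_in_disc _ (0, 0) 1) => w /(_ _ uL); rewrite /spower mulN1r oppr_gt0.
Qed.

Let tip : plane R := (0, 1).

Lemma tip_crescent : closed_region crescent tip.
Proof. by apply/closed_crescentE; rewrite /=; split; lra. Qed.

Lemma crescent_refined : refined_domain (family crescent) (region crescent).
Proof.
apply: refined_region crescent_star _ _ _ _.
- exact: crescent_signed.
- exact: crescent_bounded.
- move=> a; rewrite !inE => /orP[]/eqP ->; exists tip;
    rewrite ?trace_unitE ?trace_holeE /=; try lra; exact: tip_crescent.
- move=> p _; apply: (@card_le_two _ _ (trace unit_in) (trace hole_out)).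
  by move=> C [/familyP[a + ->] _] /=; rewrite !inE => /orP[]/eqP ->; [left|right].
- have p2N0 p : trace unit_in p -> trace hole_out p -> p.2 != 0.
    by move=> /trace_unitE h1 /trace_holeE h2; apply/eqP => p2; move: h1 h2; rewrite p2; nra.
  move=> p a b _; rewrite !inE => /orP[]/eqP -> /orP[]/eqP ->; rewrite ?eqxx// => _ h1 h2;
  by apply: trace_det => //=; rewrite ?p2N0//; apply/eqP; lra.
Qed.

Lemma cut_crescent_refined : refined_domain (family cut_crescent) (region cut_crescent).
Proof.
apply: refined_region cut_crescent_star _ _ _ _.
- exact: cut_crescent_signed.
- by apply: crescent_bounded => a; rewrite !inE => /orP[] ->; rewrite ?orbT.
- move=> a; rewrite !inE => /or3P[]/eqP ->.
  + exists (-1, 0); last by rewrite trace_unitE /=; lra.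
    by apply/closed_cut_crescentE; split; [apply/closed_crescentE; split|]; rewrite /=; lra.
  + exists (- (1 / 5), 2 / 5); last by rewrite trace_holeE /=; lra.
    by apply/closed_cut_crescentE; split; [apply/closed_crescentE; split|]; rewrite /=; lra.
  + exists (- (1 / 10), 4 / 5); last by rewrite trace_cutE /=; lra.
    by apply/closed_cut_crescentE; split; [apply/closed_crescentE; split|]; rewrite /=; lra.
- move=> p _.
  have sub : curves_at (family cut_crescent) p `<=`
      [set C | C p /\ (C = trace unit_in \/ C = trace hole_out \/ C = trace cut_out)].
    by move=> C [/familyP[a + ->] ap]; rewrite /= !inE => /or3P[]/eqP aE; rewrite aE in ap *;
      split => //; [left|right; left|right; right].
  (* No point is on all three circles: the first two meet where [p.1 = 0] and the squared norm is 1,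
     whereas the third would require 29 / 20. *)
  have [/trace_unitE up|up] := pselect (trace unit_in p).
    have [/trace_holeE hp|hp] := pselect (trace hole_out p).
      apply: (@card_le_two _ _ (trace unit_in) (trace hole_out)) => C /sub[Cp].
      move=> [|[]] CE; [by left|by right|]; move: Cp; rewrite CE => /trace_cutE; lra.
    apply: (@card_le_two _ _ (trace unit_in) (trace cut_out)) => C /sub[Cp].
    by move=> [|[]] CE; [left| |right] => //; case: hp; rewrite -CE.
  apply: (@card_le_two _ _ (trace hole_out) (trace cut_out)) => C /sub[Cp].
  by move=> [|[]] CE; [|left|right] => //; case: up; rewrite -CE.
- have p2N0 p a b : a \in cut_crescent -> b \in cut_crescent -> a != b ->
      trace a p -> trace b p -> p.2 != 0.
    rewrite !inE => /or3P[]/eqP -> /or3P[]/eqP ->; rewrite ?eqxx// => _;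
    rewrite ?trace_unitE ?trace_holeE ?trace_cutE => h1 h2; apply/eqP => p2;
    by move: h1 h2; rewrite p2; nra.
  move=> p a b _ aL bL ab ap bp; have p2 := p2N0 p a b aL bL ab ap bp.
  move: aL bL ab; rewrite !inE => /or3P[]/eqP -> /or3P[]/eqP ->; rewrite ?eqxx// => _;
  by apply: trace_det => //=; apply/eqP; lra.
Qed.

Lemma cut_refined : refined_domain (family [:: cut_in]) (region [:: cut_in]).
Proof.
apply: refined_region cut_star _ _ _ _.
- by move=> a; rewrite inE => /eqP ->; split => /=; [lra|right].
- apply: (@bounded_in_disc _ (4, 0) (349 / 20)) => w /(_ cut_in).
  by rewrite inE eqxx /spower mulN1r oppr_gt0; apply.
- move=> a; rewrite inE => /eqP ->; exists (- (1 / 10), 4 / 5); last by apply/trace_cutE => /=; lra.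
  by move=> b; rewrite inE => /eqP ->; rewrite /spower /power /=; lra.
- move=> p _; apply: (@card_le_two _ _ (trace cut_in) (trace cut_in)).
  by move=> C [/familyP[a + ->] _] /=; rewrite !inE => /eqP ->; left.
- by move=> p a b _; rewrite !inE => /eqP -> /eqP ->; rewrite eqxx.
Qed.

(** The abscissa [- 9 / 80] is that of the radical axis of the hole and the cutting circle; between
    it and 0, the points of the first axis are inside the hole. *)
Lemma tips_only w : closed_region crescent w -> closed_region [:: cut_in] w ->
  - (9 / 80) <= w.1 <= 0 /\ w.2 != 0.
Proof.
move=> cw /(_ cut_in); rewrite inE eqxx => /(_ isT); rewrite /spower /power /=.
have w0 := crescent_le0 cw; move/closed_crescentE: cw => [h1 h2] h3.
have h4 : - (9 / 80) <= w.1 by lra.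
split; first by rewrite h4.
by apply/eqP => w2; move: h2; rewrite w2; nra.
Qed.

Lemma crescent_double_points :
  double_points (family crescent) `<=` [set tip; (0, -1)].
Proof.
move=> p /double_pointsP[C [C' [/familyP[a + ->] /familyP[b + ->]]]].
have both : trace unit_in p -> trace hole_out p -> [set tip; (0, -1)] p.
  move=> /trace_unitE h1 /trace_holeE h2.
  have p1 : p.1 = 0 by lra.
  have /eqP : (p.2 - 1) * (p.2 + 1) = 0 by move: h1; rewrite p1; lra.
  rewrite mulf_eq0 subr_eq0 addr_eq0 => /orP[]/eqP p2; [left|right];
  by rewrite /= [LHS]surjective_pairing p1 p2.
by rewrite !inE => /orP[]/eqP -> /orP[]/eqP -> h1 h2 //; move=> _; exact: both.
Qed.

Lemma crescent_poles p : poles (family crescent) (region crescent) p ->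
  [\/ p.1 = 0, p.1 = 2 | p.2 = 0].
Proof.
move=> [i _ [[_ /crescent_double_points[->|->]]|/projection_singular_extreme]].
- by constructor 1.
- by constructor 1.
move=> [C [/familyP[a + ->] _]]; rewrite !inE => /orP[]/eqP -> h.
  have [| |e|e] := h (0, 0) 1; [lra|by []|by constructor 1|by constructor 3].
have [| |e|e] := h (2, 0) 5; [lra|by []|by constructor 2|by constructor 3].
Qed.

Lemma crescent_example : disconnected_LS_circles (family crescent) (region crescent)
  (poles (family crescent) (region crescent)) (trace cut_out) (region [:: cut_in]) tip.
Proof.
have circS : family crescent `<=` @circle R by apply: family_circle; exact: crescent_signed.
have circj : circle (trace cut_out) by exists (4, 0), (349 / 20); split => //; lra.
have famj : [set trace cut_out] = family [:: cut_in].
  apply/seteqP; split => [C ->|C /familyP[a + ->]].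
    by apply/familyP; exists cut_in => //; rewrite inE.
  by rewrite inE => /eqP ->.
have famS : family crescent `|` [set trace cut_out] = family cut_crescent.
  apply/seteqP; split => [C [/familyP[a + ->]|->]|C /familyP[a + ->]].
  - rewrite !inE => aL; apply/familyP; exists a => //.
    by rewrite !inE orbA aL.
  - by apply/familyP; exists cut_out => //; rewrite !inE eqxx !orbT.
  - rewrite !inE orbA => /orP[aL|/eqP ->]; last by right.
    by left; apply/familyP; exists a => //; rewrite !inE.
have clD := region_closure crescent_star; have clDj := region_closure cut_star.
have DE : region crescent `&` ~` closure (region [:: cut_in]) = region cut_crescent.
  rewrite clDj; apply/seteqP; split => [w [Dw ncw] a|w Dw].
    rewrite !inE => /or3P[]/eqP ->; try by apply: Dw; rewrite !inE eqxx ?orbT.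
    rewrite ltNge; apply/negP => h; apply: ncw => b; rewrite inE => /eqP ->.
    by move: h; rewrite /spower mul1r mulN1r oppr_ge0.
  split; first by move=> a aL; apply: Dw; move: aL; rewrite !inE => /orP[]->; rewrite ?orbT.
  move=> /(_ cut_in); rewrite inE eqxx => /(_ isT).
  have := Dw cut_out; rewrite !inE eqxx !orbT => /(_ isT).
  by rewrite /spower /=; lra.
have clt : closed_region [:: cut_in] tip.
  by move=> a; rewrite inE => /eqP ->; rewrite /spower /power /=; lra.
split.
- by apply: refined_domain_poles => //; exact: crescent_refined.
- by [].
- split; first by move=> a; rewrite inE => /eqP ->; rewrite /spower /power /=; lra.
  split; first by rewrite clD; exact: tip_crescent.
  by move=> /(_ unit_in); rewrite inE eqxx => /(_ isT); rewrite /spower /power /=; lra.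
- apply: admissible_poles => //; rewrite ?famj ?famS ?DE.
  + move=> /familyP[a + aE]; rewrite !inE => aL.
    have : trace a tip by case/orP: aL => /eqP ->; rewrite ?trace_unitE ?trace_holeE /=; lra.
    by rewrite -aE trace_cutE /=; lra.
  + exact: crescent_refined.
  + exact: cut_refined.
  + by rewrite -famj famS; exact: cut_crescent_refined.
- exact: circS.
- by move=> C [/circS|->].
(* By [tips_only], the poles in the cut part have a nonzero second coordinate and a nonpositive
   first one, so they lie on the vertical line through the tip. *)
- right; split.
    apply: finite_setD; apply: finite_setIl; apply: finite_setIl.
    apply: poles_finite => //; by case: crescent_refined.
  move=> p [[[pp]]]; rewrite clD clDj => cj cp _.
  have [/andP[p1 p1'] p2] := tips_only cp cj.
  case: (crescent_poles pp) => h; [by left|by lra|by rewrite h eqxx in p2].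
(* The second coordinate never vanishes on the intersection, yet takes opposite signs at the two
   tips. *)
- rewrite /domain_connected clD clDj => con.
  have p2N0 w : (closed_region [:: cut_in] `&` closed_region crescent) w -> w.2 != 0.
    by move=> [cj cw]; have [] := tips_only cw cj.
  have low : (closed_region [:: cut_in] `&` closed_region crescent) (0, -1).
    split; last by apply/closed_crescentE; rewrite /=; split; lra.
    by move=> a; rewrite inE => /eqP ->; rewrite /spower /power /=; lra.
  case: (connected_sign con (@snd_continuous R) p2N0) => h.
    by have /= := h _ low; lra.
  by have /= := h tip (conj clt tip_crescent); lra.
Qed.

End Example.

Theorem theorem2 (R : realType) :
  (forall (S : set (set (plane R))) (D A Sj Dj : set (plane R)) (x : plane R),
     disconnected_LS_circles S D A Sj Dj x ->
     (forall C : set (plane R), circle C ->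
        ~ (C `<=` closure Dj `&` boundary D)) /\
     contains_double_points S D Dj 2) /\
  (forall l : nat,
     (forall (S : set (set (plane R))) (D A Sj Dj : set (plane R))
             (x : plane R),
        disconnected_LS_circles S D A Sj Dj x ->
        contains_double_points S D Dj l) ->
     (l <= 2)%N).
Proof.
split=> [S D A Sj Dj x H|l Hl].
  split; last exact: contains_two_double_points H.
  by move=> C; exact: no_boundary_circle H.
(* For the crescent, all double points of the family are among the two tips, which bounds [l]. *)
have dpl := Hl _ _ _ _ _ _ (crescent_example R).
rewrite -card_le_II; apply: card_le_trans dpl _.
apply: card_le_trans (card_le_two (@crescent_double_points R)).
by apply: subset_card_le => p [].
Qed.
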